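(* There is an algorithm that takes a graph $G$ on $n$ vertices as input, runs in $\mathcal{O}^{\star}(3.076^{k_{v}})$ time, and correctly decides whether $G$ is monopolar. If $G$ is monopolar, then this algorithm also outputs one monopolar partition of the vertex set of $G$. Here $k_{v}$ is the smallest number of vertices that need to be deleted from $G$ to obtain a claw-free graph.
   Context: All graphs are finite, simple and undirected. A graph is a cluster graph if each connected component is complete. A partition $V=C\uplus I$ of the vertex set of $G=(V,E)$ is a monopolar partition if $G[C]$ is a cluster graph and $I$ is independent in $G$; $G$ is monopolar if it has one. A claw is the complete bipartite graph $K_{1,3}$; a graph is claw-free if it contains no induced claw. The algorithm is not given $k_v$ or any modulator as input. $\mathcal{O}^{\star}$ hides factors polynomial in $n$. *)

(* Defs.v *)
From mathcomp Require Import all_boot.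

Set Implicit Arguments.
Unset Strict Implicit.
Unset Printing Implicit Defensive.

Record graph := Graph {
  vertex :> finType;
  adj : rel vertex;
  adj_sym : symmetric adj;
  adj_irr : irreflexive adj
}.
Arguments adj {g} x y.

Section Induced.
Variables (G : graph) (A : {set G}).

Definition induced_adj : rel {x : G | x \in A} := fun x y => adj (val x) (val y).

Fact induced_adj_sym : symmetric induced_adj.
Proof. by move=> x y; apply: adj_sym. Qed.

Fact induced_adj_irr : irreflexive induced_adj.
Proof. by move=> x; apply: adj_irr. Qed.

Definition induced : graph := Graph induced_adj_sym induced_adj_irr.
End Induced.

Section CompleteBipartite.
Variables m n : nat.

Definition biclique_adj : rel ('I_m + 'I_n)%type := fun x y =>
  match x, y with inl _, inr _ | inr _, inl _ => true | _, _ => false end.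

Fact biclique_adj_sym : symmetric biclique_adj.
Proof. by do 2!case=> ?. Qed.

Fact biclique_adj_irr : irreflexive biclique_adj.
Proof. by case. Qed.

Definition biclique : graph := Graph biclique_adj_sym biclique_adj_irr.
End CompleteBipartite.

Definition claw : graph := biclique 1 3.

Definition has_induced (H G : graph) : bool :=
  [exists f : {ffun H -> G},
    injectiveb f && [forall x, forall y, adj (f x) (f y) == adj x y]].

Definition claw_free (G : graph) : bool := ~~ has_induced claw G.

(* The default [set: G] is feasible: see claw_free_delT below. *)
Definition claw_free_deletion_number (G : graph) : nat :=
  #|[arg min_(S < [set: G] | claw_free (induced (~: S))) #|S|]|.

Fact claw_free_delT (G : graph) : claw_free (induced (~: [set: G])).
Proof.
apply/existsP => -[f _].
by case: (f (inl ord0)) => x /=; rewrite !inE.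
Qed.

Definition component (G : graph) (x : G) : {set G} := [set y | connect adj x y].

Definition clique (G : graph) (A : {set G}) : Prop :=
  {in A &, forall x y, x != y -> adj x y}.

Definition cluster_graph (G : graph) : Prop := forall x : G, clique (component x).

Definition independent (G : graph) (A : {set G}) : Prop :=
  {in A &, forall x y, ~~ adj x y}.

(* Either part may be empty. *)
Definition monopolar_partition (G : graph) (C J : {set G}) : Prop :=
  [/\ C :|: J = [set: G], C :&: J = set0,
      cluster_graph (induced C) & independent J].

Definition monopolar (G : graph) : Prop :=
  exists C J : {set G}, monopolar_partition C J.

(* Model of computation: first-order, call-by-value programs over binary
   trees, in the style of Jones's WHILE and F languages.  A program is a
   finite list of mutually recursive unary functions; function 0 is the entry
   point.  Every operation is charged one unit and is a constant-time pointer
   manipulation, so t units are simulated by a logarithmic-cost random access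
   machine with O(log t) overhead per unit.  There are no arithmetic
   operations and no equality test on trees. *)
Inductive tree := Leaf | Node of tree & tree.

Inductive expr :=
  | EVar of nat                 (* de Bruijn index *)
  | ELeaf
  | ENode of expr & expr
  | EHd of expr
  | ETl of expr
  | EIf of expr & expr & expr   (* Leaf is false, Node is true *)
  | ELet of expr & expr         (* the second expression sees the first as EVar 0 *)
  | ECall of nat & expr.

Definition program := seq expr.

Definition tree_hd (v : tree) := if v is Node a _ then a else Leaf.
Definition tree_tl (v : tree) := if v is Node _ b then b else Leaf.
Definition truthy (v : tree) := if v is Node _ _ then true else false.

(* eval p env e v t: in program p and environment env, expression e evaluates
   to v in exactly t time units. *)
Inductive eval (p : program) : seq tree -> expr -> tree -> nat -> Prop :=
  | eval_var env i :
      eval p env (EVar i) (nth Leaf env i) 1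
  | eval_leaf env :
      eval p env ELeaf Leaf 1
  | eval_node env e1 e2 v1 v2 t1 t2 :
      eval p env e1 v1 t1 -> eval p env e2 v2 t2 ->
      eval p env (ENode e1 e2) (Node v1 v2) (t1 + t2).+1
  | eval_hd env e v t :
      eval p env e v t -> eval p env (EHd e) (tree_hd v) t.+1
  | eval_tl env e v t :
      eval p env e v t -> eval p env (ETl e) (tree_tl v) t.+1
  | eval_if env e e1 e2 v w t s :
      eval p env e v t -> eval p env (if truthy v then e1 else e2) w s ->
      eval p env (EIf e e1 e2) w (t + s).+1
  | eval_let env e1 e2 v w t s :
      eval p env e1 v t -> eval p (v :: env) e2 w s ->
      eval p env (ELet e1 e2) w (t + s).+1
  | eval_call env f e v w t s :
      eval p env e v t -> eval p [:: v] (nth ELeaf p f) w s ->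
      eval p env (ECall f e) w (t + s).+1.

Lemma eval_det (p : program) env e v v' t t' :
  eval p env e v t -> eval p env e v' t' -> v = v' /\ t = t'.
Proof.
move=> ev; elim: ev v' t' => {env e v t}; intros;
  match goal with K : eval _ _ _ ?w ?s |- _ = ?w /\ _ => inversion K; subst end;
  repeat match goal with
  | IH : forall w s, eval p ?env ?e w s -> _, K : eval p ?env ?e _ _ |- _ =>
    case: (IH _ _ K) => ? ?; subst; clear IH K
  end; by [].
Qed.

(* On input x, program p halts with output y after t time units. *)
Definition runs (p : program) (x y : tree) (t : nat) : Prop :=
  eval p [:: x] (nth ELeaf p 0) y t.

Definition enc_bool (b : bool) : tree := if b then Node Leaf Leaf else Leaf.

Definition enc_seq (s : seq tree) : tree := foldr Node Leaf s.

(* The adjacency matrix, row by row, in the order of enum G. *)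
Definition enc_graph (G : graph) : tree :=
  enc_seq [seq enc_seq [seq enc_bool (adj x y) | y <- enum G] | x <- enum G].

(* The characteristic vector, in the order of enum G. *)
Definition enc_set (G : graph) (A : {set G}) : tree :=
  enc_seq [seq enc_bool (x \in A) | x <- enum G].

(* Leaf means no; a Node means yes and carries the two parts. *)
Definition enc_answer (G : graph) (o : option ({set G} * {set G})) : tree :=
  if o is Some (C, J) then Node (enc_set C) (enc_set J) else Leaf.

(* Main.v *)
Require Import Defs.
From mathcomp Require Import all_boot all_order all_algebra.
From mathcomp Require Import zify lra.

(** Any modulator S to claw-free graphs contains a vertex of every claw, so whole claws may be put
into S at the price of one unit of the budget.  Spending five units on one claw taken entirely and
four claws branched on vertex by vertex costs 4 ^ 4 = 256 nodes of a search tree and yields at most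
8 vertices, hence 2 ^ 8 = 256 guesses of S :&: J for the independent part J; and 256 < 3.076 ^ 5.
The budget 5 m is increased until a modulator is found.

Once S :&: J is guessed, the rest is 2-SAT.  Let K contain S :\: J, the neighbours of S :&: J and
the vertices of degree 3 of induced diamonds; these avoid J.  Induced paths on three vertices
meeting K give 2-clauses, and so does the pendant edge of an induced paw, one end of which lies in
J.  If a solution J of these clauses is extended to a maximal independent set avoiding K, then an
induced path u - v - w avoiding J would have a middle vertex v with a neighbour t in J outside S,
and {u, v, w, t} would induce a claw outside S, a diamond or a paw.

The program is an interpreter for formulas and loops over registers holding vertex sets, together
with a backtracking search whose levels are lists of alternative commands. *)

Set Implicit Arguments.
Unset Strict Implicit.
Unset Printing Implicit Defensive.

(** * A register language over vertex sets *)

(* Variables are registers holding vertex sets; a vertex is a singleton. *)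
Inductive form :=
  | FMeet of nat & nat
  | FAdj of nat & nat
  | FNot of form
  | FAnd of form & form
  | FEx of nat & form.

(* [CSet i j f] assigns to register i the set of all x such that f holds when register j
   contains [set x]; [CPick i j f] keeps only the first such x. *)
Inductive cmd :=
  | CSet of nat & nat & form
  | CPick of nat & nat & form
  | CSeq of cmd & cmd
  | CFor of nat & cmd.

Section Semantics.
Variable G : graph.
Implicit Types (e : nat -> {set G}) (A : {set G}).

Definition upd e i A : nat -> {set G} := fun j => if eqn j i then A else e j.

Fixpoint fsem (f : form) e : bool :=
  match f with
  | FMeet i j => [exists x, (x \in e i) && (x \in e j)]
  | FAdj i j => [exists x, (x \in e i) && [exists y, adj x y && (y \in e j)]]
  | FNot f => ~~ fsem f e
  | FAnd f g => fsem f e && fsem g e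
  | FEx i f => [exists x, fsem f (upd e i [set x])]
  end.

Definition comp e j f : {set G} := [set x | fsem f (upd e j [set x])].

Definition first_set A : {set G} := if enum A is x :: _ then [set x] else set0.

Fixpoint csem (c : cmd) e : nat -> {set G} :=
  match c with
  | CSet i j f => upd e i (comp e j f)
  | CPick i j f => upd e i (first_set (comp e j f))
  | CSeq c d => csem d (csem c e)
  | CFor i c => foldl (fun e x => csem c (upd e i [set x])) e (enum G)
  end.

(** Depth-first search: all alternatives of a level start from the same state, and a leaf succeeds
    when register 0, the flag, is nonempty. The inner fixpoint runs through the alternatives of one
    level. *)
Fixpoint search (s : seq (seq cmd)) e : option (nat -> {set G}) :=
  if s is cs :: s' then
    (fix alts cs := if cs is c :: cs' then
       if search s' (csem c e) is Some e' then Some e' else alts cs'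
     else None) cs
  else if e 0 != set0 then Some e else None.

End Semantics.

Definition width := 19.

Fixpoint fwf (f : form) : bool :=
  match f with
  | FMeet i j | FAdj i j => (i < width) && (j < width)
  | FNot f => fwf f
  | FAnd f g => fwf f && fwf g
  | FEx i f => (i < width) && fwf f
  end.

Fixpoint cwf (c : cmd) : bool :=
  match c with
  | CSet i j f | CPick i j f => [&& i < width, j < width & fwf f]
  | CSeq c d => cwf c && cwf d
  | CFor i c => (i < width) && cwf c
  end.

(** * The algorithm as register commands and search schedules *)

Definition FOr f g := FNot (FAnd (FNot f) (FNot g)).

(* rF: success flag; rS: modulator; rc, ra, rb, rd: current claw (also bound variables);
   rL, rJ: labelled part of S and its part in J; rK: vertices forced out of J;
   rI, rC, rI1, rC1, rI2, rC2: partial assignments of the 2-SAT solver. *)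
Local Notation rF := 0 (only parsing).
Local Notation rS := 1 (only parsing).
Local Notation rc := 2 (only parsing).
Local Notation ra := 3 (only parsing).
Local Notation rb := 4 (only parsing).
Local Notation rd := 5 (only parsing).
Local Notation rL := 6 (only parsing).
Local Notation rJ := 7 (only parsing).
Local Notation rK := 8 (only parsing).
Local Notation rI := 9 (only parsing).
Local Notation rC := 10 (only parsing).
Local Notation rI1 := 11 (only parsing).
Local Notation rC1 := 12 (only parsing).
Local Notation rI2 := 13 (only parsing).
Local Notation rC2 := 14 (only parsing).
Local Notation vx := 15 (only parsing).
Local Notation vy := 16 (only parsing).
Local Notation vu := 17 (only parsing).
Local Notation vv := 18 (only parsing).

(** For singletons: an induced claw with centre [c] and leaves [a], [b], [d], all outside [rS]. *)
Definition clawF c a b d :=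
  FAnd (FAnd (FAnd (FAdj c a) (FAnd (FAdj c b) (FAdj c d)))
             (FNot (FOr (FAdj a b) (FOr (FAdj a d) (FAdj b d)))))
       (FAnd (FNot (FOr (FMeet a b) (FOr (FMeet a d) (FMeet b d))))
             (FNot (FOr (FMeet c rS) (FOr (FMeet a rS) (FOr (FMeet b rS) (FMeet d rS)))))).

(** Each pick demands that the vertices still to be chosen exist, so the picks never get stuck. If
    no claw is left, [rc] becomes empty, which falsifies [clawF] and empties the other three
    registers as well. *)
Definition find_claw :=
  CSeq (CPick rc rc (FEx ra (FEx rb (FEx rd (clawF rc ra rb rd)))))
  (CSeq (CPick ra ra (FEx rb (FEx rd (clawF rc ra rb rd))))
  (CSeq (CPick rb rb (FEx rd (clawF rc ra rb rd)))
        (CPick rd rd (clawF rc ra rb rd)))).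

Definition pack :=
  CSeq find_claw (CSet rS vv (FOr (FMeet vv rS) (FOr (FMeet vv rc)
     (FOr (FMeet vv ra) (FOr (FMeet vv rb) (FMeet vv rd)))))).

Definition branch r := CSeq find_claw (CSet rS vv (FOr (FMeet vv rS) (FMeet vv r))).

(** The formula does not mention [vv], so the flag becomes the set of all vertices or the empty set;
    it represents a truth value as soon as the graph is nonempty. *)
Definition check_claw_free :=
  CSet rF vv (FNot (FEx rc (FEx ra (FEx rb (FEx rd (clawF rc ra rb rd)))))).

(** Marks the next vertex of the modulator as labelled, leaving it out of [rJ]; once all of them are
    labelled, [rL] and [rJ] stay unchanged. *)
Definition label_pick := CSeq (CPick rc rc (FAnd (FMeet rc rS) (FNot (FMeet rc rL))))
  (CSet rL vv (FOr (FMeet vv rL) (FMeet vv rc))).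
Definition label_in := CSeq label_pick (CSet rJ vv (FOr (FMeet vv rJ) (FMeet vv rc))).

Definition p3F a b c :=
  FAnd (FAnd (FAdj a b) (FAdj b c)) (FNot (FOr (FAdj a c) (FMeet a c))).

(** A vertex adjacent to all of an induced path on three vertices has degree 3 in an induced
    diamond. *)
Definition diamondF v := FEx ra (FEx rb (FEx rd
  (FAnd (FAnd (FAdj v ra) (FAnd (FAdj v rb) (FAdj v rd))) (p3F ra rb rd)))).

(** A triangle [v], [ra], [rb] with the pendant edge from [v] to [u]; here [u] differs from [rb]
    because [ra] is adjacent to [rb] but not to [u]. *)
Definition pawF v u := FEx ra (FEx rb
  (FAnd (FAnd (FAdj ra rb) (FAdj v rb)) (FAnd (p3F u v ra) (FNot (FAdj u rb))))).

(** Clauses forbidding that both [x] and [y] lie in J; those of [relRF] require one of them in J. A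
    unit clause is written as a clause with [x] equal to [y]. *)
Definition relAF x y := FOr (FAdj x y) (FAnd (FMeet x y) (FMeet x rK)).
Definition relRF x y :=
  FOr (FAnd (FMeet x y) (FMeet x rJ))
  (FOr (FEx ra (FAnd (FMeet ra rK) (FOr (p3F ra x y) (FOr (p3F x ra y) (p3F x y ra)))))
       (FOr (pawF x y) (pawF y x))).

(** Unit propagation. The variable [vy] is a mere counter: one round is performed per vertex. *)
Definition close i c :=
  CFor vy (CSeq (CSet i vv (FOr (FMeet vv i) (FEx vu (FAnd (FMeet vu c) (relRF vu vv)))))
                (CSet c vv (FOr (FMeet vv c) (FEx vu (FAnd (FMeet vu i) (relAF vu vv)))))).

Definition choose r r1 r2 := CSet r vv
  (FOr (FAnd (FNot (FMeet rI1 rC1)) (FMeet vv r1)) (FAnd (FMeet rI1 rC1) (FMeet vv r2))).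

(** Tries [vx] in J, then [vx] outside J, propagating each choice; the second outcome is kept only
    if the first is contradictory. *)
Definition twosat_step :=
  CSeq (CSet rI1 vv (FOr (FMeet vv rI) (FMeet vv vx)))
  (CSeq (CSet rC1 vv (FMeet vv rC))
  (CSeq (close rI1 rC1)
  (CSeq (CSet rI2 vv (FMeet vv rI))
  (CSeq (CSet rC2 vv (FOr (FMeet vv rC) (FMeet vv vx)))
  (CSeq (close rI2 rC2)
  (CSeq (choose rI rI1 rI2) (choose rC rC1 rC2))))))).

Definition empty_set r := CSet r vv (FNot (FMeet vv vv)).

Definition force := CSet rK vv (FOr (FAnd (FMeet vv rS) (FNot (FMeet vv rJ)))
                                   (FOr (FAdj vv rJ) (diamondF vv))).

Definition maximalize := CFor vx (CSet rI vv (FOr (FMeet vv rI)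
  (FAnd (FMeet vv vx) (FNot (FOr (FMeet vx rK) (FAdj vx rI)))))).

(** Verifies the partition found, so that soundness does not rest on the solver. As for
    [check_claw_free], the flag becomes everything or nothing. *)
Definition check_partition := CSet rF vv
  (FNot (FOr (FAdj rI rI) (FEx ra (FEx rb (FEx rd
    (FAnd (FAnd (FMeet ra rC) (FAnd (FMeet rb rC) (FMeet rd rC))) (p3F ra rb rd))))))).

Definition solve :=
  CSeq force (CSeq (empty_set rI) (CSeq (empty_set rC) (CSeq (CFor vx twosat_step)
  (CSeq maximalize (CSeq (CSet rC vv (FNot (FMeet vv rI))) check_partition))))).

Definition branches := [:: branch rc; branch ra; branch rb; branch rd].
Definition labels := [:: label_in; label_pick].
Definition block1 := [:: [:: pack]; branches; branches; branches; branches].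
Definition block2 := nseq 8 labels.
Fixpoint sched1 m := if m is m'.+1 then block1 ++ sched1 m' else [:: [:: check_claw_free]].
Fixpoint sched2 m := if m is m'.+1 then block2 ++ sched2 m' else [:: [:: solve]].

(** * Encoding of commands as trees, and the interpreter *)

Definition enc_nat (n : nat) : tree := enc_seq (nseq n Leaf).
(** Constructor numbers are unary, so the interpreter dispatches by testing successive tails of the
    tag. *)
Definition tagged (n : nat) (t : tree) : tree := Node (enc_nat n) t.

Fixpoint enc_form (f : form) : tree :=
  match f with
  | FMeet i j => tagged 0 (Node (enc_nat i) (enc_nat j))
  | FAdj i j => tagged 1 (Node (enc_nat i) (enc_nat j))
  | FNot f => tagged 2 (enc_form f)
  | FAnd f g => tagged 3 (Node (enc_form f) (enc_form g))
  | FEx i f => tagged 4 (Node (enc_nat i) (enc_form f))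
  end.

Fixpoint enc_cmd (c : cmd) : tree :=
  match c with
  | CSet i j f => tagged 0 (Node (enc_nat i) (Node (enc_nat j) (enc_form f)))
  | CPick i j f => tagged 1 (Node (enc_nat i) (Node (enc_nat j) (enc_form f)))
  | CSeq c d => tagged 2 (Node (enc_cmd c) (enc_cmd d))
  | CFor i c => tagged 3 (Node (enc_nat i) (enc_cmd c))
  end.

Definition enc_alts (cs : seq cmd) := enc_seq (map enc_cmd cs).
Definition enc_sched (s : seq (seq cmd)) := enc_seq (map enc_alts s).

(** Programs have no literals: a constant tree is rebuilt from its constructors, in time [tsize]. *)
Fixpoint quote (t : tree) : expr :=
  if t is Node a b then ENode (quote a) (quote b) else ELeaf.
Fixpoint tsize (t : tree) : nat := if t is Node a b then (tsize a + tsize b).+1 else 1.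

Definition ETrue := ENode ELeaf ELeaf.
Definition EAnd a b := EIf a b ELeaf.
Definition hd2 e := EHd (ETl e).
Definition tl2 e := ETl (ETl e).
Local Notation arg := (EVar 0) (only parsing).
Local Notation arg1 := (EVar 1) (only parsing).

Definition e_meet :=
  EIf (EHd arg)
    (EIf (EAnd (EHd (EHd arg)) (EHd (ETl arg))) ETrue
         (ECall 1 (ENode (ETl (EHd arg)) (ETl (ETl arg)))))
    ELeaf.

Definition e_adj :=
  EIf (EHd arg)
    (EIf (EAnd (EHd (hd2 arg)) (ECall 1 (ENode (EHd (EHd arg)) (tl2 arg)))) ETrue
         (ECall 2 (ENode (ETl (EHd arg)) (ENode (ETl (hd2 arg)) (tl2 arg)))))
    ELeaf.

Definition e_nth :=
  EIf (EHd arg) (ECall 3 (ENode (ETl (EHd arg)) (tl2 arg))) (hd2 arg).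

Definition e_set :=
  EIf (EHd arg)
    (ENode (EHd (tl2 arg)) (ECall 4 (ENode (ETl (EHd arg)) (ENode (hd2 arg) (ETl (tl2 arg))))))
    (ENode (hd2 arg) (ETl (tl2 arg))).

(** An existential is evaluated by computing the set of all its witnesses with function 6 and
    testing this set for nonemptiness by meeting it with itself. The payload of [FEx] already has
    the shape that function 6 expects. *)
Definition e_holds :=
  let tag := EHd (EHd arg) in let pl := ETl (EHd arg) in
  let env := hd2 arg in let g := tl2 arg in
  let look i := ECall 3 (ENode i env) in
  let sub f := ECall 5 (ENode f (ETl arg)) in
  EIf tag (EIf (ETl tag) (EIf (ETl (ETl tag)) (EIf (ETl (ETl (ETl tag)))
    (ELet (ECall 6 (ENode (ETl g) (ENode pl (ETl arg)))) (ECall 1 (ENode arg arg)))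
    (EIf (sub (EHd pl)) (sub (ETl pl)) ELeaf))
    (EIf (sub pl) ELeaf ETrue))
    (ECall 2 (ENode (EHd g) (ENode (look (EHd pl)) (look (ETl pl))))))
    (ECall 1 (ENode (look (EHd pl)) (look (ETl pl)))).

Definition e_comp :=
  let us := EHd arg in let j := EHd (hd2 arg) in let f := ETl (hd2 arg) in
  let env := EHd (tl2 arg) in let g := ETl (tl2 arg) in
  EIf us
    (ENode (ECall 5 (ENode f (ENode (ECall 4 (ENode j (ENode (EHd us) env))) g)))
           (ECall 6 (ENode (ETl us) (ETl arg))))
    ELeaf.

Definition e_zeros := EIf arg (ENode ELeaf (ECall 7 (ETl arg))) ELeaf.

Definition e_first :=
  EIf arg (EIf (EHd arg) (ENode ETrue (ECall 7 (ETl arg))) (ENode ELeaf (ECall 8 (ETl arg))))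
    ELeaf.

Definition e_exec :=
  let tag := EHd (EHd arg) in let pl := ETl (EHd arg) in
  let env := hd2 arg in let g := tl2 arg in
  let comp := ECall 6 (ENode (ETl g) (ENode (ETl pl) (ETl arg))) in
  EIf tag (EIf (ETl tag) (EIf (ETl (ETl tag))
    (ECall 10 (ENode (ETl g) (ENode pl (ETl arg))))
    (ECall 9 (ENode (ETl pl) (ENode (ECall 9 (ENode (EHd pl) (ETl arg))) g))))
    (ECall 4 (ENode (EHd pl) (ENode (ECall 8 comp) env))))
    (ECall 4 (ENode (EHd pl) (ENode comp env))).

Definition e_for :=
  let us := EHd arg in let i := EHd (hd2 arg) in let c := ETl (hd2 arg) in
  let env := EHd (tl2 arg) in let g := ETl (tl2 arg) in
  EIf us
    (ECall 10 (ENode (ETl us) (ENode (hd2 arg)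
       (ENode (ECall 9 (ENode c (ENode (ECall 4 (ENode i (ENode (EHd us) env))) g))) g))))
    env.

(** An encoded environment is a [Node], hence truthy, so [Leaf] can stand for failure. *)
Definition e_search :=
  let flag := EHd (hd2 arg) in
  EIf (EHd arg) (ECall 12 (ENode (EHd (EHd arg)) (ENode (ETl (EHd arg)) (ETl arg))))
    (EIf (ECall 1 (ENode flag flag)) (hd2 arg) ELeaf).

Definition e_alts :=
  EIf (EHd arg)
    (ELet (ECall 11 (ENode (hd2 arg)
             (ENode (ECall 9 (ENode (EHd (EHd arg)) (tl2 arg))) (ETl (tl2 arg)))))
       (EIf arg arg (ECall 12 (ENode (ETl (EHd arg1)) (ETl arg1)))))
    ELeaf.

(** The budget is not stored as a number: after a failed first stage both schedules grow by one
    literal block. Once a modulator is found, the second stage decides and the loop ends. *)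
Definition e_loop :=
  ELet (ECall 11 (ENode (EHd arg) (tl2 arg)))
    (EIf arg
      (ELet (ECall 11 (ENode (hd2 arg1) (ENode arg (ETl (tl2 arg1)))))
         (EIf arg (ENode (ECall 3 (ENode (quote (enc_nat rC)) arg))
                         (ECall 3 (ENode (quote (enc_nat rI)) arg))) ELeaf))
      (ECall 13 (ENode (foldr (fun cs => ENode (quote (enc_alts cs))) (EHd arg1) block1)
        (ENode (foldr (fun cs => ENode (quote (enc_alts cs))) (hd2 arg1) block2) (tl2 arg1))))).

Definition e_shift := EIf arg (ENode (ENode ELeaf (EHd arg)) (ECall 14 (ETl arg))) ELeaf.

(** The list of singletons is the identity matrix, built from the length of the argument alone: the
    first row is a one followed by zeros, the others are the rows of the smaller matrix shifted by
    one place. *)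
Definition e_units :=
  EIf arg (ENode (ENode ETrue (ECall 7 (ETl arg))) (ECall 14 (ECall 15 (ETl arg)))) ELeaf.

(** On the empty graph no register can be nonempty, so the flag could never signal success; the
    answer with two empty parts is given directly. *)
Definition e_main :=
  EIf arg
    (ELet (ECall 7 arg)
      (ECall 13 (ENode (quote (enc_sched (sched1 0))) (ENode (quote (enc_sched (sched2 0)))
         (ENode (iter width (ENode arg) ELeaf) (ENode arg1 (ECall 15 arg1)))))))
    (ENode ELeaf ELeaf).

(* Arguments are nested pairs; the last component g of a call is the adjacency matrix paired with
   the list of all singletons. *)
Definition prog : program :=
  [:: e_main; e_meet; e_adj; e_nth; e_set; e_holds; e_comp; e_zeros; e_first; e_exec;
      e_for; e_search; e_alts; e_loop; e_shift; e_units].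

(** * Evaluation within a time bound *)

Definition evalb env e v B := exists2 t, eval prog env e v t & t <= B.
Definition runf f x y B := evalb [:: x] (nth ELeaf prog f) y B.

Lemma evb_le env e v v' B B' : evalb env e v B -> v = v' -> B <= B' -> evalb env e v' B'.
Proof. by move=> [t h1 h2] <- h; exists t => //; apply: leq_trans h. Qed.

Lemma evb_node env e1 e2 v1 v2 B1 B2 : evalb env e1 v1 B1 -> evalb env e2 v2 B2 ->
  evalb env (ENode e1 e2) (Node v1 v2) (B1 + B2).+1.
Proof. by move=> [t ? ?] [s ? ?]; exists (t + s).+1; [constructor | rewrite ltnS leq_add]. Qed.

Lemma evb_hd env e v B : evalb env e v B -> evalb env (EHd e) (tree_hd v) B.+1.
Proof. by move=> [t ? ?]; exists t.+1 => //; constructor. Qed.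

Lemma evb_tl env e v B : evalb env e v B -> evalb env (ETl e) (tree_tl v) B.+1.
Proof. by move=> [t ? ?]; exists t.+1 => //; constructor. Qed.

Lemma evb_leaf env : evalb env ELeaf Leaf 1.
Proof. by exists 1 => //; constructor. Qed.

Lemma evb_var env i : evalb env (EVar i) (nth Leaf env i) 1.
Proof. by exists 1 => //; constructor. Qed.

Lemma evb_if env e e1 e2 v w B1 B2 : evalb env e v B1 ->
  evalb env (if truthy v then e1 else e2) w B2 -> evalb env (EIf e e1 e2) w (B1 + B2).+1.
Proof.
by move=> [t ? ?] [s ? ?]; exists (t + s).+1; [apply: eval_if; eauto | rewrite ltnS leq_add].
Qed.

Lemma evb_let env e1 e2 v w B1 B2 : evalb env e1 v B1 -> evalb (v :: env) e2 w B2 ->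
  evalb env (ELet e1 e2) w (B1 + B2).+1.
Proof.
by move=> [t ? ?] [s ? ?]; exists (t + s).+1; [apply: eval_let; eauto | rewrite ltnS leq_add].
Qed.

Lemma evb_call env f e v w B1 B2 : evalb env e v B1 -> runf f v w B2 ->
  evalb env (ECall f e) w (B1 + B2).+1.
Proof.
by move=> [t ? ?] [s ? ?]; exists (t + s).+1; [apply: eval_call; eauto | rewrite ltnS leq_add].
Qed.

Lemma evb_quote env t : evalb env (quote t) t (tsize t).
Proof. by elim: t => [|a ha b hb] /=; [apply: evb_leaf | apply: evb_node]. Qed.

(* Runs a body symbolically up to the next call; the goals left are the calls, conditionals on
   unknown Booleans, and finally the comparison of values and of costs. *)
Ltac ev1 := lazymatch goal with
  | |- evalb _ (EVar _) _ _ => eapply evb_var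
  | |- evalb _ ELeaf _ _ => eapply evb_leaf
  | |- evalb _ (ENode _ _) _ _ => eapply evb_node
  | |- evalb _ (EHd _) _ _ => eapply evb_hd
  | |- evalb _ (ETl _) _ _ => eapply evb_tl
  | |- evalb _ (EIf _ _ _) _ _ => eapply evb_if
  | |- evalb _ (ELet _ _) _ _ => eapply evb_let
  | |- evalb _ (ECall _ _) _ _ => eapply evb_call
  | |- evalb _ (quote _) _ _ => eapply evb_quote
  | |- evalb _ (if truthy ?v then _ else _) _ _ =>
      let b := eval hnf in (truthy v) in
      lazymatch b with
      | true => change (truthy v) with true; cbv iota
      | false => change (truthy v) with false; cbv iota
      end
  | |- runf _ _ _ _ => progress cbn [tree_hd tree_tl nth]
  end.
Ltac ev := repeat ev1.

Ltac body e := rewrite /runf; match goal with |- evalb _ ?x _ _ => change x with e end;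
  cbv beta zeta delta [e EAnd ETrue hd2 tl2].

Tactic Notation "evw" tactic3(t) := repeat first [ev1 | solve [t]].

(** * Cost functions for formulas, commands and schedules *)

Section Cost.
Variable n : nat.

(** Covers one adjacency test between two sets, which is quadratic in n, with ample room for
    constant overheads. *)
Definition base := 3000 * (n.+1 * n.+1).

Lemma base_lin : 3000 * n.+1 <= base.
Proof. by rewrite /base; nia. Qed.

Lemma base_adj : n.+1 * (40 * n.+1 + 100) + 2500 <= base.
Proof. by rewrite /base; nia. Qed.

Fixpoint cost_f (f : form) : nat :=
  match f with
  | FMeet _ _ | FAdj _ _ => base
  | FNot f => cost_f f + base
  | FAnd f g => cost_f f + cost_f g + base
  | FEx _ f => n.+1 * (cost_f f + base) + base
  end.

Fixpoint cost_c (c : cmd) : nat :=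
  match c with
  | CSet _ _ f | CPick _ _ f => n.+1 * (cost_f f + base) + base
  | CSeq c d => cost_c c + cost_c d + base
  | CFor _ c => n.+1 * (cost_c c + base) + base
  end.

Definition cost_s (p : nat) (sch : seq (seq cmd)) : nat :=
  foldr (fun cs t => size cs * (p + t + 200) + 200) base sch.

End Cost.

Definition gorder (G : graph) : nat := #|G|.

(** Schedules of every length are assembled from these finitely many commands, so the sum [max_cost]
    of their costs bounds each command of any schedule. *)
Definition cmds := [:: [:: check_claw_free]; [:: solve]] ++ block1 ++ block2.
Definition max_cost n := sumn (map (cost_c n) (flatten cmds)).
Definition block_size bs := sumn [seq (tsize (enc_alts cs)).+1 | cs <- bs].
Definition level_cost n := max_cost n + base n + 400.
(** The schedules have 5 m + 1 and 8 m + 1 levels, and the full search tree of either has 256 ^ m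
    leaves. *)
Definition stage_cost n m := (8 * m + 3) * level_cost n * 256 ^ m.
Definition loop_cost n m := 2 * stage_cost n m + block_size block1 + block_size block2 + 2000.

(** As no level is empty, each depth of the search tree has at most as many nodes as there are
    leaves. Positivity of the product is carried along to absorb the additive terms. *)
Lemma cost_s_bound n sch : all (fun cs => 0 < size cs) sch ->
  cost_s n (max_cost n) sch <= (size sch).+1 * level_cost n * \prod_(cs <- sch) size cs.
Proof.
move=> h; have hb := base_lin n.
suff [] : cost_s n (max_cost n) sch <= (size sch).+1 * level_cost n * \prod_(cs <- sch) size cs
          /\ 0 < \prod_(cs <- sch) size cs by [].
elim: sch h => [_|cs sch IH /= /andP[h /IH{IH}[]]].
  by rewrite big_nil /cost_s /level_cost /=; lia.
rewrite big_cons -/(cost_s _ _ _); move: (cost_s _ _ _) => t.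
move: (\prod_(_ <- _) _) (size cs) h => q a a0 ht q0; split; last by rewrite muln_gt0 a0.
have : a * (max_cost n + t + 200) <= a * (max_cost n + 200 + (size sch).+1 * level_cost n * q).
  by rewrite leq_mul2l; lia.
have : max_cost n + 400 <= level_cost n by rewrite /level_cost; lia.
move: (level_cost n) => l hl h1; have : l <= l * q by rewrite leq_pmulr.
nia.
Qed.

(** * Correctness and running time of the interpreter *)

Section Runs.
Variable G : graph.
Implicit Types (s : seq G) (P Q : pred G) (A : {set G}) (l : seq tree) (e : nat -> {set G}).
Notation n := (gorder G).

Lemma size_enumG : size (enum G) = n.
Proof. by rewrite -cardE. Qed.

(** Characteristic vectors over an arbitrary list, because the recursions of the program run through
    suffixes of [enum G]. *)
Definition bits s P := enc_seq [seq enc_bool (P x) | x <- s].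

Lemma bits_cons x s P : bits (x :: s) P = Node (enc_bool (P x)) (bits s P).
Proof. by []. Qed.

Lemma run_meet s P Q :
  runf 1 (Node (bits s P) (bits s Q)) (enc_bool (has (fun x => P x && Q x) s)) (40 * (size s).+1).
Proof.
elim: s => [|x s IH]; body e_meet.
  by eapply evb_le; [ev | |].
rewrite /bits /=; case: (P x); case: (Q x);
  (eapply evb_le; [ev; apply: IH | by [] | by rewrite /=; lia]).
Qed.

Lemma run_adj s P Q :
  runf 2 (Node (enc_seq [seq bits (enum G) (adj x) | x <- s]) (Node (bits s P) (bits (enum G) Q)))
    (enc_bool (has (fun x => P x && has (fun y => adj x y && Q y) (enum G)) s))
    ((size s).+1 * (40 * n.+1 + 100)).
Proof.
elim: s => [|x s IH]; body e_adj.
  by eapply evb_le; [ev | |lia].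
have := run_meet (enum G) (adj x) Q; rewrite size_enumG bits_cons.
rewrite [has _ (x :: s)]/=; set h := has _ (enum G); case: h => hm; case: (P x);
  (eapply evb_le; [evw (first [apply: IH | apply: hm]) | by [] | by rewrite /=; lia]).
Qed.

Lemma run_nth l i : i < size l -> runf 3 (Node (enc_nat i) (enc_seq l)) (nth Leaf l i) (20 * i.+1).
Proof.
elim: i l => [|i IH] [|x l] //= hi; body e_nth; (eapply evb_le; [ev;
  apply: IH hi | by [] | by rewrite /=; lia]).
Qed.

Lemma run_set l i w : i < size l ->
  runf 4 (Node (enc_nat i) (Node w (enc_seq l))) (enc_seq (set_nth Leaf l i w)) (30 * i.+1).
Proof.
elim: i l => [|i IH] [|x l] //= hi; body e_set; (eapply evb_le; [ev;
  apply: IH hi | by [] | by rewrite /=; lia]).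
Qed.

Lemma run_zeros l : runf 7 (enc_seq l) (enc_seq [seq Leaf | _ <- l]) (20 * (size l).+1).
Proof.
elim: l => [|x l IH]; body e_zeros; (eapply evb_le; [ev; apply: IH | by [] | by rewrite /=; lia]).
Qed.

Definition enc_env e := enc_seq [seq enc_set (e i) | i <- iota 0 width].
Definition units := [seq enc_set [set x] | x <- enum G].
Definition gctx := Node (enc_graph G) (enc_seq units).

Lemma run_look e i : i < width -> runf 3 (Node (enc_nat i) (enc_env e)) (enc_set (e i)) 400.
Proof.
move=> hi; eapply evb_le; first by apply: (@run_nth [seq enc_set (e i) | i <- iota 0 width]);
  rewrite size_map size_iota.
  by rewrite (nth_map 0) ?size_iota // nth_iota.
by rewrite /width in hi; lia.
Qed.

Lemma run_upd e i A : i < width ->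
  runf 4 (Node (enc_nat i) (Node (enc_set A) (enc_env e))) (enc_env (upd e i A)) 600.
Proof.
move=> hi; eapply evb_le; first by apply: (@run_set [seq enc_set (e i) | i <- iota 0 width]);
  rewrite size_map size_iota.
  congr enc_seq; apply: (@eq_from_nth _ Leaf).
    by rewrite size_set_nth !size_map !size_iota; apply/maxn_idPr.
  move=> j; rewrite size_set_nth !size_map !size_iota (maxn_idPr _) // => hj.
  rewrite nth_set_nth (nth_map 0) ?size_iota // nth_iota // add0n /upd eqnE.
  rewrite -[LHS]/(if j == i then enc_set A else nth Leaf [seq enc_set (e k) | k <- iota 0 width] j).
  by case: eqP => // _; rewrite (nth_map 0) ?size_iota // nth_iota.
by rewrite /width in hi; lia.
Qed.

Local Notation base := (base n).
Local Notation cost_f := (cost_f n).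
Local Notation cost_c := (cost_c n).

Definition holds_ok f := forall e,
  runf 5 (Node (enc_form f) (Node (enc_env e) gctx)) (enc_bool (fsem f e)) (cost_f f).

Lemma run_comp f i : holds_ok f -> i < width -> forall s e,
  runf 6 (Node (enc_seq [seq enc_set [set x] | x <- s])
               (Node (Node (enc_nat i) (enc_form f)) (Node (enc_env e) gctx)))
         (bits s (fun x => fsem f (upd e i [set x]))) ((size s).+1 * (cost_f f + 1000)).
Proof.
move=> hf hi s e; elim: s => [|x s IH]; body e_comp.
  by eapply evb_le; [ev | | lia].
rewrite [[seq _ | _ <- x :: s]]/=.
eapply evb_le; [evw (first [exact: run_upd | exact: hf | exact: IH]) | by [] | by rewrite /=; lia].
Qed.

Lemma has_enum P : has P (enum G) = [exists x, P x].
Proof.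
apply/hasP/existsP => [[x _ px]|[x px]]; exists x => //; exact: mem_enum.
Qed.

Lemma bits_set A : enc_set A = bits (enum G) (mem A).
Proof. by []. Qed.

Lemma bits_comp e j f : bits (enum G) (fun x => fsem f (upd e j [set x])) = enc_set (comp e j f).
Proof. by congr enc_seq; apply: eq_map => x; rewrite inE. Qed.

Lemma run_meet_sets A B :
  runf 1 (Node (enc_set A) (enc_set B)) (enc_bool [exists x, (x \in A) && (x \in B)]) (40 * n.+1).
Proof.
have := run_meet (enum G) (mem A) (mem B); rewrite -!bits_set size_enumG.
by rewrite has_enum.
Qed.

Lemma run_adj_sets A B :
  runf 2 (Node (enc_graph G) (Node (enc_set A) (enc_set B)))
    (enc_bool [exists x, (x \in A) && [exists y, adj x y && (y \in B)]])
    (n.+1 * (40 * n.+1 + 100)).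
Proof.
have := run_adj (enum G) (mem A) (mem B); rewrite size_enumG has_enum => h.
eapply evb_le; [exact: h | | by []].
by congr enc_bool; apply: eq_existsb => x; rewrite has_enum.
Qed.

Lemma fsem_ex e i f : fsem (FEx i f) e = [exists x, (x \in comp e i f) && (x \in comp e i f)].
Proof. by apply: eq_existsb => x; rewrite andbb inE. Qed.

Lemma run_holds f : fwf f -> holds_ok f.
Proof.
elim: f => [i j|i j|f IH|f IHf g IHg|i f IH] /= wf e; body e_holds; rewrite [enc_form _]/= /tagged.
- case/andP: wf => hi hj.
  eapply evb_le; [evw (first [exact: run_look | exact: run_meet_sets]) | by [] |].
  by have := base_lin n; rewrite /=; lia.
- case/andP: wf => hi hj.
  eapply evb_le; [evw (first [exact: run_look | exact: run_adj_sets]) | by [] |].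
  by have := base_adj n; rewrite /=; lia.
- have := IH wf e; rewrite [fsem (FNot f) e]/=; case: (fsem f e) => h;
  (eapply evb_le; [evw (exact: h) | by [] | by have := base_lin n; rewrite /=; lia]).
- case/andP: wf => hf hg; have := IHf hf e; have := IHg hg e.
  rewrite [fsem (FAnd f g) e]/=; case: (fsem f e); case: (fsem g e) => h1 h2;
  (eapply evb_le; [evw (first [exact: h2 | exact: h1]) | by [] | by have := base_lin n; rewrite /=;
    lia]).
- case/andP: wf => hi hf; have := run_comp (IH hf) hi (enum G) e; rewrite bits_comp size_enumG => h.
  eapply evb_le; [evw (first [exact: h | exact: run_meet_sets]) | by rewrite -fsem_ex |].
  by have := base_lin n; rewrite /=; lia.
Qed.

Lemma run_comp_set f i e : fwf f -> i < width ->
  runf 6 (Node (enc_seq units) (Node (Node (enc_nat i) (enc_form f)) (Node (enc_env e) gctx)))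
         (enc_set (comp e i f)) (n.+1 * (cost_f f + 1000)).
Proof.
by move=> /run_holds hf hi; have := run_comp hf hi (enum G) e; rewrite bits_comp size_enumG.
Qed.

(** The condition in the output singles out the first hit; without repetitions in [s] it holds at
    one position at most. *)
Lemma run_first s P : uniq s ->
  runf 8 (bits s P) (bits s (fun x => if [seq y <- s | P y] is y :: _ then x == y else false))
    (40 * (size s).+1).
Proof.
elim: s => [_|x s IH /=/andP[xs us]]; body e_first; first by eapply evb_le; [ev | |].
rewrite bits_cons; case px: (P x).
  have := run_zeros [seq enc_bool (P x) | x <- s]; rewrite size_map => hz.
  eapply evb_le; [evw (exact: hz) | | by rewrite /=; lia].
  rewrite bits_cons eqxx; congr (Node _ (enc_seq _)); rewrite -map_comp.
  by apply/eq_in_map => y ys /=; case: eqP => // e; rewrite -e ys in xs.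
eapply evb_le; [evw (exact: IH) | | by rewrite /=; lia].
rewrite bits_cons; congr (Node _ _); case E: [seq y <- s | P y] => [//|y t].
have : y \in s by have := mem_head y t; rewrite -E mem_filter => /andP[].
by case: (x =P y) => // <-; rewrite (negPf xs).
Qed.

Lemma run_first_set A : runf 8 (enc_set A) (enc_set (first_set A)) (40 * n.+1).
Proof.
have := run_first (mem A) (enum_uniq G); rewrite -bits_set size_enumG => h.
eapply evb_le; [exact: h | | by []]; congr enc_seq; apply: eq_map => x; congr enc_bool.
rewrite /first_set enumT -[[seq _ <- _ | _]]/(enum A).
by case: (enum A) => [|y t]; rewrite inE.
Qed.

Lemma run_for i c : i < width ->
  (forall e, runf 9 (Node (enc_cmd c) (Node (enc_env e) gctx)) (enc_env (csem c e)) (cost_c c)) ->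
  forall s e,
  runf 10 (Node (enc_seq [seq enc_set [set x] | x <- s])
                (Node (Node (enc_nat i) (enc_cmd c)) (Node (enc_env e) gctx)))
     (enc_env (foldl (fun e x => csem c (upd e i [set x])) e s)) ((size s).+1 * (cost_c c + 1000)).
Proof.
move=> hi hc; elim=> [|x s IH] e; body e_for; first by eapply evb_le; [ev | | lia].
rewrite [[seq _ | _ <- x :: s]]/=.
eapply evb_le; [evw (first [exact: run_upd | exact: hc | exact: IH]) | by [] | by rewrite /=; lia].
Qed.

Lemma run_exec c e : cwf c ->
  runf 9 (Node (enc_cmd c) (Node (enc_env e) gctx)) (enc_env (csem c e)) (cost_c c).
Proof.
elim: c e => [i j f|i j f|c IHc d IHd|i c IH] e wf; body e_exec; rewrite [enc_cmd _]/= /tagged.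
- case/and3P: wf => hi hj hf.
  eapply evb_le; [evw (first [exact: run_comp_set | exact: run_upd]) | by [] |].
  by have := base_lin n; rewrite /=; lia.
- case/and3P: wf => hi hj hf.
  eapply evb_le; [evw (first [exact: run_comp_set | exact: run_first_set | exact: run_upd]) | by []
    |].
  by have := base_lin n; rewrite /=; lia.
- case/andP: wf => hc hd.
  eapply evb_le; [evw (first [exact: IHc | exact: IHd]) | by [] |].
  by have := base_lin n; rewrite /=; lia.
case/andP: wf => hi hc.
have := run_for hi (fun e => IH e hc) (enum G) e; rewrite size_enumG => h.
eapply evb_le; [evw (exact: h) | by [] |].
by have := base_lin n; rewrite /=; lia.
Qed.

Definition enc_res (o : option (nat -> {set G})) : tree := if o is Some e then enc_env e else Leaf.

(** The inner fixpoint of [search] under a name, so that the induction over the alternatives can be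
    stated. *)
Definition alts sch e := fix alts cs :=
  if cs is c :: cs' then if search sch (csem c e) is Some e' then Some e' else alts cs' else None.

Local Notation cost_s := (cost_s n).

Lemma run_search (p : nat) sch e :
  all (all (fun c => cwf c && (cost_c c <= p))) sch ->
  runf 11 (Node (enc_sched sch) (Node (enc_env e) gctx)) (enc_res (search sch e)) (cost_s p sch).
Proof.
elim: sch e => [|cs sch IH] e.
  move=> _; body e_search; have := run_meet_sets (e 0) (e 0); have hb := base_lin n.
  have -> : [exists x, (x \in e 0) && (x \in e 0)] = (e 0 != set0).
    by apply/existsP/set0Pn => -[x hx]; exists x; move: hx; rewrite andbb.
  rewrite [search _ _]/=; case: (e 0 != set0) => h;
  (eapply evb_le; [evw (exact: h) | by [] | by rewrite /cost_s /=; lia]).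
case/andP => hcs /IH{}IH; body e_search.
have {IH}halts : runf 12 (Node (enc_alts cs) (Node (enc_sched sch) (Node (enc_env e) gctx)))
   (enc_res (alts sch e cs)) (size cs * (p + cost_s p sch + 200) + 100).
  elim: cs hcs => [_|c cs IHc /= /andP[/andP[wc hc] /IHc{}IHc]]; body e_alts.
    by eapply evb_le; [ev | | lia].
  rewrite [enc_alts _]/=; have h1 := run_exec e wc; have := IH (csem c e).
  case: (search sch (csem c e)) => [e'|] h2;
  (eapply evb_le; [evw (first [exact: h1 | exact: h2 | exact: IHc]) | by [] | by rewrite /=; lia]).
by eapply evb_le; [evw (exact: halts) | | rewrite /= -/(cost_s p sch); lia].
Qed.

Lemma map_const (T T' : Type) (c : T') (s : seq T) : [seq c | _ <- s] = nseq (size s) c.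
Proof. by elim: s => //= x s ->. Qed.

Lemma run_shift (l : seq (seq tree)) :
  runf 14 (enc_seq (map enc_seq l)) (enc_seq [seq enc_seq (Leaf :: r) | r <- l]) (30 * (size l).+1).
Proof.
elim: l => [|r l IH]; body e_shift; first by eapply evb_le; [ev | |].
by rewrite /=; eapply evb_le; [evw (exact: IH) | | rewrite /=; lia].
Qed.

(** Stated for any [l] of the right length, because the recursion descends along the rows of the
    adjacency matrix and uses them only as a counter. *)
Lemma run_units_seq s l : uniq s -> size l = size s ->
  runf 15 (enc_seq l) (enc_seq [seq bits s (pred1 x) | x <- s]) ((size s).+1 * (60 * (size s).+1)).
Proof.
elim: s l => [|x s IH] [|r l] //=.
  by move=> _ _; body e_units; eapply evb_le; [ev | |].
case/andP=> xs us [hl]; have {}IH := IH _ us hl.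
have := run_zeros l; rewrite hl => hz.
have := run_shift [seq [seq enc_bool (pred1 y z) | z <- s] | y <- s];
  rewrite size_map -map_comp => hs.
body e_units; eapply evb_le; [evw (first [exact: hz | exact: IH | exact: hs]) | | by rewrite /=;
  nia].
have ns y : y \in s -> (x == y = false) * (y == x = false).
  by move=> ys; case: eqP => [e|/nesym/eqP/negPf->//]; rewrite -e (negPf xs) in ys.
rewrite bits_cons /pred1 /= eqxx; congr (Node (Node _ (enc_seq _)) (enc_seq _)).
  rewrite map_const hl -(map_const Leaf s).
  by apply/eq_in_map => y ys /=; rewrite ns.
by rewrite -map_comp; apply/eq_in_map => y ys; rewrite bits_cons /= ns.
Qed.

Lemma run_units : runf 15 (enc_graph G) (enc_seq units) (n.+1 * (60 * n.+1)).
Proof.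
have := run_units_seq (enum_uniq G) (size_map (fun x => bits (enum G) (adj x)) (enum G)).
rewrite size_enumG => h; eapply evb_le; [exact: h | | by []].
by congr enc_seq; apply: eq_map => x; congr enc_seq; apply: eq_map => y; rewrite inE.
Qed.

Lemma evb_foldr env bs sch x B : evalb env x (enc_sched sch) B ->
  evalb env (foldr (fun cs => ENode (quote (enc_alts cs))) x bs) (enc_sched (bs ++ sch))
    (B + sumn [seq (tsize (enc_alts cs)).+1 | cs <- bs]).
Proof.
move=> h; elim: bs => [|cs bs IH]; first by rewrite addn0.
by eapply evb_le; [apply: evb_node; [exact: evb_quote | exact: IH] | | rewrite /=; lia].
Qed.

Lemma cmds_ok : all (all (fun c => cwf c && (cost_c c <= max_cost n))) cmds.
Proof.
have wf : all (all cwf) cmds by [].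
have hc : all (fun c => cost_c c <= max_cost n) (flatten cmds).
  rewrite /max_cost; elim: (flatten cmds) => //= c cs IH; rewrite leq_addr /=.
  by apply: sub_all IH => d /leq_trans; apply; rewrite leq_addl.
move: wf hc; move: (max_cost n) => p; elim: cmds => //= cs sch IH /andP[h1 /IH{}IH].
rewrite all_cat => /andP[h2 /IH->]; rewrite andbT.
by elim: cs h1 h2 => //= c cs IHc /andP[-> /IHc{}IHc] /andP[-> /IHc->].
Qed.

Lemma schedS m : sched1 m.+1 = block1 ++ sched1 m /\ sched2 m.+1 = block2 ++ sched2 m.
Proof. by []. Qed.

Lemma sched_ok m :
  all (all (fun c => cwf c && (cost_c c <= max_cost n))) (sched1 m) /\
  all (all (fun c => cwf c && (cost_c c <= max_cost n))) (sched2 m).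
Proof.
have := cmds_ok; move: (all (fun c => cwf c && (cost_c c <= max_cost n))) => ok.
rewrite /cmds !all_cat => /andP[/and3P[hc hs _]] /andP[h1 h2].
elim: m => [|m [IH1 IH2]]; first by rewrite /sched1 /sched2 !all_seq1.
by have [-> ->] := schedS m; rewrite !all_cat h1 h2 IH1 IH2.
Qed.

Lemma sched_prod m : \prod_(cs <- sched1 m) size cs = 256 ^ m /\ \prod_(cs <- sched2 m) size cs =
  256 ^ m.
Proof.
elim: m => [|m [IH1 IH2]]; first by rewrite !big_cons !big_nil.
have [-> ->] := schedS m; rewrite !big_cat /= IH1 IH2 expnS.
by rewrite !big_cons !big_nil.
Qed.

Lemma sched_size m : size (sched1 m) = 5 * m + 1 /\ size (sched2 m) = 8 * m + 1.
Proof. by elim: m => // m [/= -> ->]; lia. Qed.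

Lemma sched_pos m : all (fun cs => 0 < size cs) (sched1 m) /\ all (fun cs => 0 < size cs) (sched2
  m).
Proof. by elim: m => // m [h1 h2]; split => /=. Qed.

Lemma stage_cost_mono m m' : m <= m' -> stage_cost n m <= stage_cost n m'.
Proof.
move=> h; rewrite /stage_cost leq_mul ?leq_mul //; first by lia.
by rewrite leq_exp2l.
Qed.

Lemma run_stage1 m e : runf 11 (Node (enc_sched (sched1 m)) (Node (enc_env e) gctx))
  (enc_res (search (sched1 m) e)) (stage_cost n m).
Proof.
eapply evb_le; [exact: (run_search e (proj1 (sched_ok m))) | by [] |].
apply: leq_trans (cost_s_bound n (proj1 (sched_pos m))) _.
rewrite (proj1 (sched_prod m)) (proj1 (sched_size m)) /stage_cost !leq_mul //; lia.
Qed.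

Lemma run_stage2 m e : runf 11 (Node (enc_sched (sched2 m)) (Node (enc_env e) gctx))
  (enc_res (search (sched2 m) e)) (stage_cost n m).
Proof.
eapply evb_le; [exact: (run_search e (proj2 (sched_ok m))) | by [] |].
apply: leq_trans (cost_s_bound n (proj2 (sched_pos m))) _.
rewrite (proj2 (sched_prod m)) (proj2 (sched_size m)) /stage_cost !leq_mul //; lia.
Qed.

Definition enc_out (o : option (nat -> {set G})) : tree :=
  if o is Some e then Node (enc_set (e rC)) (enc_set (e rI)) else Leaf.

(** Success is assumed for the budget m + j only, so [j] bounds the number of rounds that can still
    fail. Each round costs at most what a round with budget m + j costs, and [m'] is the budget at
    which the first stage succeeds. *)
Lemma run_loop e j m : search (sched1 (m + j)) e -> exists m' e',
  search (sched1 m') e = Some e' /\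
  runf 13 (Node (enc_sched (sched1 m)) (Node (enc_sched (sched2 m)) (Node (enc_env e) gctx)))
    (enc_out (search (sched2 m') e')) (j.+1 * loop_cost n (m + j)).
Proof.
elim: j m => [|j IH] m hm.
  move: hm; rewrite addn0; case E: search => [e'|] // _; exists m, e'; split=> //.
  have := run_stage1 m e; have := run_stage2 m e'; rewrite E.
  case: (search (sched2 m) e') => [e2|] h2 h1; body e_loop;
  (eapply evb_le; [evw (first [exact: h1 | exact: h2 | exact: run_look]) | by [] |
    by rewrite /loop_cost /=; lia]).
case E: (search (sched1 m) e) => [e'|].
  exists m, e'; split=> //; have := run_stage1 m e; have := run_stage2 m e'; rewrite E.
  have := @stage_cost_mono m (m + j.+1) (leq_addr _ _) => hmono.
  case: (search (sched2 m) e') => [e2|] h2 h1; body e_loop;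
  (eapply evb_le; [evw (first [exact: h1 | exact: h2 | exact: run_look]) | by [] |
    by rewrite mulSn /loop_cost /=; lia]).
have [|m' [e' [he' hr]]] := IH m.+1; first by rewrite addSnnS.
exists m', e'; split=> //; have := run_stage1 m e; rewrite E => h1.
have := @stage_cost_mono m (m + j.+1) (leq_addr _ _) => hmono.
rewrite addSnnS in hr; body e_loop.
set env := [:: enc_res None; Node (enc_sched (sched1 m))
                               (Node (enc_sched (sched2 m)) (Node (enc_env e) gctx))].
have f1 := @evb_foldr env block1 (sched1 m) _ _ (evb_hd (evb_var env 1)).
have f2 := @evb_foldr env block2 (sched2 m) _ _ (evb_hd (evb_tl (evb_var env 1))).
eapply evb_le; [evw (first [exact: h1 | exact: hr | exact: f1 | exact: f2]) | by [] |].
rewrite -/(block_size block1) -/(block_size block2) mulSn.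
by have := leqnn (loop_cost n (m + j.+1)); rewrite {1}/loop_cost; lia.
Qed.

Lemma run_main e : 0 < n -> (forall i, e i = set0) -> forall M, search (sched1 M) e -> exists m' e',
  search (sched1 m') e = Some e' /\
  runf 0 (enc_graph G) (enc_out (search (sched2 m') e'))
    (M.+1 * loop_cost n M + base + tsize (enc_sched (sched1 0)) + tsize (enc_sched (sched2 0))).
Proof.
move=> n0 he M /(@run_loop e M 0) [m [e' [h1 h2]]]; exists m, e'; split=> //; body e_main.
have hz := run_zeros (map (fun x => bits (enum G) (adj x)) (enum G));
  rewrite size_map size_enumG in hz.
have hu := run_units; have hb := base_adj n.
have tg : truthy (enc_graph G) = true.
  by move: n0; rewrite -size_enumG /enc_graph; case: (enum G).
(* The initial state, with all registers empty, is built by [e_main] as [width] copies of the zero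
   vector. *)
have henv : enc_env e = iter width (Node (enc_set (set0 : {set G}))) Leaf .
  by rewrite /enc_env; elim: width 0 => //= w IH k; rewrite he IH.
have hitr k t : evalb [:: t; enc_graph G] (iter k (ENode arg) ELeaf) (iter k (Node t) Leaf) (2 * k
  + 1).
  elim: k => [|k IH]; first exact: evb_leaf.
  by eapply evb_le; [apply: evb_node; [exact: evb_var | exact: IH] | | lia].
have {hz}hz : runf 7 (enc_graph G) (enc_set (set0 : {set G})) (20 * n.+1).
  eapply evb_le; [exact: hz | | by []].
  by rewrite -map_comp; congr enc_seq; apply: eq_map => x; rewrite inE.
rewrite henv in h2.
eapply evb_le; [apply: evb_if; [exact: evb_var | rewrite [nth _ _ _]/= tg] | by [] |].
evw (first [exact: hz | exact: h2 | exact: hu | exact: hitr]).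
move: (hb) (tsize _) (tsize _) (M.+1 * _) => {}hb a b c; rewrite /base in hb *.
rewrite /width; nia.
Qed.
End Runs.

(** * Finding a modulator by packing claws and branching on them *)

Section Graph.
Variable G : graph.
Implicit Types (x y z u v w a b c d : G) (A B I C J K S T : {set G}) (e : nat -> {set G}).

Arguments upd G e i A j /.

Definition p3 x y z := [&& adj x y, adj y z, ~~ adj x z & x != z].
Definition claw_at c a b d :=
  [&& adj c a, adj c b, adj c d, ~~ adj a b, ~~ adj a d, ~~ adj b d, a != b, a != d & b != d].
Definition claw_out S c a b d :=
  claw_at c a b d && [&& c \notin S, a \notin S, b \notin S & d \notin S].
(** Claw-freeness of G - S, stated without forming the induced subgraph; [claw_free_modulator]
    provides the link. *)
Definition modulator S := forall c a b d, ~~ claw_out S c a b d.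

Lemma fsemMeet e i j x : e i = [set x] -> fsem (FMeet i j) e = (x \in e j).
Proof.
move=> /= ->; apply/existsP/idP => [[y]|hx]; last by exists x; rewrite set11.
by rewrite inE => /andP[/eqP->].
Qed.

Lemma fsemAdjS e i j x : e i = [set x] -> fsem (FAdj i j) e = [exists y, adj x y && (y \in e j)].
Proof.
move=> /= ->; apply/existsP/idP => [[y]|hx]; last by exists x; rewrite set11.
by rewrite inE => /andP[/eqP->].
Qed.

Lemma fsemAdj e i j x y : e i = [set x] -> e j = [set y] -> fsem (FAdj i j) e = adj x y.
Proof.
move=> hi hj; rewrite (fsemAdjS _ hi) hj; apply/existsP/idP => [[z]|h]; last by exists y;
  rewrite set11 h.
by rewrite inE => /andP[h /eqP<-].
Qed.

Lemma fsemExP e i f : reflect (exists x, fsem f (upd e i [set x])) (fsem (FEx i f) e).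
Proof. exact: existsP. Qed.

Lemma fsemAnd e f g : fsem (FAnd f g) e = fsem f e && fsem g e.
Proof. by []. Qed.

Lemma fsemNot e f : fsem (FNot f) e = ~~ fsem f e.
Proof. by []. Qed.

Lemma fsemOr e f g : fsem (FOr f g) e = fsem f e || fsem g e.
Proof. by rewrite /= negb_and !negbK. Qed.

Lemma fsem_p3 e i j k x y z : e i = [set x] -> e j = [set y] -> e k = [set z] ->
  fsem (p3F i j k) e = p3 x y z.
Proof.
move=> hi hj hk; rewrite fsemAnd fsemNot fsemOr fsemAnd (fsemAdj hi hj) (fsemAdj hj hk).
by rewrite (fsemAdj hi hk) (fsemMeet _ hi) hk inE negb_or /p3 !andbA.
Qed.

Lemma fsem_claw e c a b d : e rc = [set c] -> e ra = [set a] -> e rb = [set b] -> e rd = [set d] ->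
  fsem (clawF rc ra rb rd) e = claw_out (e rS) c a b d.
Proof.
move=> hc ha hb hd; rewrite !(fsemAnd, fsemNot, fsemOr).
rewrite (fsemAdj hc ha) (fsemAdj hc hb) (fsemAdj hc hd) (fsemAdj ha hb) (fsemAdj ha hd) (fsemAdj hb
  hd).
rewrite (fsemMeet rS hc) (fsemMeet rS ha) (fsemMeet rS hb) (fsemMeet rS hd).
rewrite (fsemMeet rb ha) (fsemMeet rd ha) (fsemMeet rd hb) hb hd !inE.
by rewrite /claw_out /claw_at !negb_or !andbA.
Qed.

Lemma fsem_claw0 e : e rc = set0 -> fsem (clawF rc ra rb rd) e = false.
Proof.
move=> h; rewrite !fsemAnd /= h;
  have -> : [exists x, (x \in set0) && [exists y, adj x y && (y \in e 3)]] = false; last by [].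
by apply/existsP => -[x]; rewrite inE.
Qed.

Lemma first_setP A : (A = set0 /\ first_set A = set0) \/ exists2 x, x \in A & first_set A = [set x].
Proof.
rewrite /first_set; case E: (enum A) => [|x s]; [left | right].
  by split=> //; apply/setP => x; rewrite -mem_enum E inE.
by exists x => //; rewrite -mem_enum E mem_head.
Qed.

Local Notation claw := (clawF rc ra rb rd).

Lemma find_clawP e : let e' := csem find_claw e in
  (forall i, i \notin [:: rc; ra; rb; rd] -> e' i = e i) /\
  (modulator (e rS) /\ [/\ e' rc = set0, e' ra = set0, e' rb = set0 & e' rd = set0] \/
   exists c a b d, claw_out (e rS) c a b d /\
     [/\ e' rc = [set c], e' ra = [set a], e' rb = [set b] & e' rd = [set d]]).
Proof.
move=> e'.
pose e1 := csem (CPick rc rc (FEx ra (FEx rb (FEx rd claw)))) e.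
pose e2 := csem (CPick ra ra (FEx rb (FEx rd claw))) e1.
pose e3 := csem (CPick rb rb (FEx rd claw)) e2.
have he' : e' = csem (CPick rd rd claw) e3 by [].
split.
  move=> i; rewrite !inE !negb_or => /and4P[h1 h2 h3 h4].
  rewrite he' /e3 /e2 /e1 {he' e1 e2 e3 e'}; cbn [csem upd]; rewrite /upd !eqnE.
  by rewrite (negPf h1) (negPf h2) (negPf h3) (negPf h4).
have n1 : e1 rc = first_set (comp e rc (FEx ra (FEx rb (FEx rd claw)))) by [].
have n2 : e2 ra = first_set (comp e1 ra (FEx rb (FEx rd claw))) by [].
have n3 : e3 rb = first_set (comp e2 rb (FEx rd claw)) by [].
have n4 : e' rd = first_set (comp e3 rd claw) by [].
have o1 : e' rc = e1 rc by []. have o2 : e' ra = e2 ra by []. have o3 : e' rb = e3 rb by [].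
have s1 : e1 rS = e rS by []. have c2 : e2 rc = e1 rc by []. have s2 : e2 rS = e rS by [].
have c3 : e3 rc = e1 rc by []. have a3 : e3 ra = e2 ra by []. have s3 : e3 rS = e rS by [].
clearbody e1 e2 e3 e'; rewrite o1 o2 o3 {he'}.
case: (first_setP (comp e rc (FEx ra (FEx rb (FEx rd claw))))) => [[E h]|[c]].
  left; split.
    move=> c a b d; apply/negP => hcl; have : c \in comp e rc (FEx ra (FEx rb (FEx rd claw))).
      rewrite inE; apply/fsemExP; exists a; apply/fsemExP; exists b; apply/fsemExP; exists d.
      by rewrite (fsem_claw (c := c) (a := a) (b := b) (d := d)).
    by rewrite E inE.
  rewrite h in n1; rewrite n2 n3 n4; split=> //.
  - case: (first_setP (comp e1 ra (FEx rb (FEx rd claw)))) => [[]//|[x]].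
    by rewrite inE => /fsemExP[y /fsemExP[z]]; rewrite fsem_claw0 //= n1.
  - case: (first_setP (comp e2 rb (FEx rd claw))) => [[]//|[x]].
    by rewrite inE => /fsemExP[y]; rewrite fsem_claw0 //= c2 n1.
  - case: (first_setP (comp e3 rd claw)) => [[]//|[x]].
    by rewrite inE fsem_claw0 //= c3 n1.
rewrite inE => h h1; right; rewrite h1 in n1; exists c.
case/fsemExP: h => a /fsemExP[b /fsemExP[d]].
rewrite (fsem_claw (c := c) (a := a) (b := b) (d := d)) //= => h.
case: (first_setP (comp e1 ra (FEx rb (FEx rd claw)))) => [[E _]|[a']].
  have : a \in comp e1 ra (FEx rb (FEx rd claw)); last by rewrite E inE.
  rewrite inE; apply/fsemExP; exists b; apply/fsemExP; exists d.
  by rewrite (fsem_claw (c := c) (a := a) (b := b) (d := d)) //= s1.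
(* The vertex picked may differ from the witness at hand, so fresh witnesses for the remaining
   vertices are extracted after each pick. *)
rewrite inE => {}h h2; rewrite h2 in n2; exists a'.
case/fsemExP: h => {}b /fsemExP[{}d].
rewrite (fsem_claw (c := c) (a := a') (b := b) (d := d)) //= s1 => h.
case: (first_setP (comp e2 rb (FEx rd claw))) => [[E _]|[b']].
  have : b \in comp e2 rb (FEx rd claw); last by rewrite E inE.
  rewrite inE; apply/fsemExP; exists d.
  by rewrite (fsem_claw (c := c) (a := a') (b := b) (d := d)) //= ?s2 ?c2.
rewrite inE => {}h h3; rewrite h3 in n3; exists b'.
case/fsemExP: h => {}d.
rewrite (fsem_claw (c := c) (a := a') (b := b') (d := d)) //= ?s2 ?c2 // => h.
case: (first_setP (comp e3 rd claw)) => [[E _]|[d']].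
  have : d \in comp e3 rd claw; last by rewrite E inE.
  by rewrite inE (fsem_claw (c := c) (a := a') (b := b') (d := d)) //= ?s3 ?c3 ?a3.
rewrite inE (fsem_claw (c := c) (a := a') (b := b') (d := d')) //= ?s3 ?c3 ?a3 // => {}h h4.
by exists d'; rewrite n4.
Qed.

(** The nondeterministic reading of [search]: [e'] is the state at some leaf. By [search_some] and
    [search_none] it suffices to argue about the existence of a good leaf, whatever order the search
    follows. *)
Fixpoint reach (s : seq (seq cmd)) e e' : Prop :=
  if s is cs :: s' then
    exists2 i, i < size cs & reach s' (csem (nth check_claw_free cs i) e) e'
  else e = e'.

Lemma search_some s e e' : search s e = Some e' -> reach s e e' /\ e' 0 != set0.
Proof.
elim: s e => [|cs s IH] e /=; first by case: ifP => // h [<-].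
elim: cs => //= c cs IHc; case E: search => [e1|].
  by case=> ee; rewrite ee in E; have [h1 h2] := IH _ E; split=> //; exists 0.
by move=> /IHc[[i h1 h2] h3]; split=> //; exists i.+1.
Qed.

Lemma search_none s e e' : search s e = None -> reach s e e' -> e' 0 = set0.
Proof.
elim: s e => [|cs s IH] e /=; first by case: eqP => // h _ <-.
elim: cs => [|c cs IHc] /=; first by move=> _ [].
case E: search => [//|] /IHc{}IHc [[|i] hi hr]; first exact: IH E hr.
by apply: IHc; exists i.
Qed.

Lemma compU e i j k : i != k -> j != k ->
  comp e k (FOr (FMeet k i) (FMeet k j)) = e i :|: e j.
Proof.
move=> /negPf hi /negPf hj; apply/setP => x;
  rewrite !inE fsemOr !(@fsemMeet _ _ _ x) /= ?eqnE ?eqxx //.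
by rewrite hi hj.
Qed.

Lemma pack_sem e : (csem pack e) rS =
  let e' := csem find_claw e in e rS :|: (e' rc :|: (e' ra :|: (e' rb :|: e' rd))).
Proof.
rewrite -[csem pack e]/(csem (CSet _ _ _) (csem find_claw e)).
have [h _] := find_clawP e; rewrite -(h rS) //; move: (csem find_claw e) => e1.
by apply/setP => x; rewrite /= !inE !fsemOr !(@fsemMeet _ _ _ x).
Qed.

Lemma branch_sem e r : r != vv -> (csem (branch r) e) rS = e rS :|: csem find_claw e r.
Proof.
move=> hr; rewrite -[csem (branch r) e]/(csem (CSet _ _ _) (csem find_claw e)).
have [h _] := find_clawP e; rewrite -(h rS) //; exact: compU.
Qed.

Definition growing k (cs : seq cmd) := forall e i, i < size cs ->
  let e' := csem (nth check_claw_free cs i) e in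
  [/\ #|e' rS| <= #|e rS| + k, e' rL = e rL & e' rJ = e rJ].

(** The invariant of the first stage: [S] is already a modulator, or at most [k] vertices of a fixed
    modulator [T] are still missing. A [hitting] level offers an alternative that lowers [k] by
    one. *)
Definition good T k S := modulator S \/ #|T :\: S| <= k.

Definition hitting (cs : seq cmd) := forall e T k, modulator T -> good T k (e rS) ->
  exists2 i, i < size cs & good T k.-1 ((csem (nth check_claw_free cs i) e) rS).

Lemma cardsU_le A B k l : #|A| <= k -> #|B| <= l -> #|A :|: B| <= k + l.
Proof. by move=> h1 h2; apply: leq_trans (leq_card_setU A B) (leq_add h1 h2). Qed.

Lemma find_claw_card e r : r \in [:: rc; ra; rb; rd] -> #|csem find_claw e r| <= 1.
Proof.
have [_ [[_ [h1 h2 h3 h4]]|[c [a [b [d [_ [h1 h2 h3 h4]]]]]]]] := find_clawP e;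
by rewrite !inE => /or4P[] /eqP->; rewrite ?h1 ?h2 ?h3 ?h4 ?cards0 ?cards1.
Qed.

Lemma pack_growing : growing 4 [:: pack].
Proof.
move=> e [|//] _; cbv zeta; rewrite [nth _ _ _]/=.
have [h _] := find_clawP e; split; rewrite -?(h rL) -?(h rJ) //.
rewrite pack_sem; apply: cardsU_le => //.
by rewrite -[4]/(1 + (1 + (1 + 1))); do !apply: cardsU_le; apply: find_claw_card.
Qed.

Lemma branch_growing : growing 1 branches.
Proof.
move=> e i hi e'; have [r hr hb] : exists2 r, r \in [:: rc; ra; rb; rd] & e' = csem (branch r) e.
  by rewrite /e'; case: i hi {e'} => [|[|[|[|//]]]] _;
    [exists rc | exists ra | exists rb | exists rd].
have rv : r != vv by move: hr; rewrite !inE => /or4P[] /eqP->.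
rewrite {}hb {e' hi}; have [h _] := find_clawP e; split; rewrite -?(h rL) -?(h rJ) //.
by rewrite branch_sem //; apply: cardsU_le => //; apply: find_claw_card.
Qed.

Lemma hit_card T S S' x : x \in T -> x \notin S -> x \in S' -> S \subset S' ->
  #|T :\: S'| <= #|T :\: S|.-1.
Proof.
move=> xT xS xS' sS; have xTS : x \in T :\: S by rewrite inE xS.
rewrite (cardsD1 x (T :\: S)) xTS /=; apply: subset_leq_card.
apply/subsetP => y; rewrite !inE => /andP[h ->]; rewrite andbT.
by rewrite (contra (subsetP sS y) h) andbT; apply: contraNneq h => ->.
Qed.

Lemma modulator_hits T S c a b d : modulator T -> claw_out S c a b d ->
  [\/ c \in T, a \in T, b \in T | d \in T].
Proof.
move=> /(_ c a b d) h1 /andP[h2 _]; move: h1; rewrite /claw_out h2 /= !negb_and !negbK.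
by case/or4P; [constructor 1 | constructor 2 | constructor 3 | constructor 4].
Qed.

Lemma modulatorS S S' : S \subset S' -> modulator S -> modulator S'.
Proof.
move=> /subsetP sS h c a b d; apply: contra (h c a b d) => /andP[h1 h2]; rewrite /claw_out h1 /=.
by case/and4P: h2 => h2 h3 h4 h5; rewrite !(contra (sS _)).
Qed.

Lemma hit_good T k S S' x : good T k S -> S \subset S' -> ~ modulator S ->
  x \in T -> x \notin S -> x \in S' -> good T k.-1 S'.
Proof.
move=> [//|h] sS _ h1 h2 h3; right; apply: leq_trans (hit_card h1 h2 h3 sS) _.
by move: h; lia.
Qed.

(** [T] contains a vertex of the claw, so taking the claw whole gains a vertex of [T] without
    branching. *)
Lemma pack_hitting : hitting [:: pack].
Proof.
move=> e T k mT hg; exists 0 => //; rewrite [nth _ _ _]/= pack_sem; cbv zeta.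
have sS B : e rS \subset e rS :|: B by apply: subsetUl.
have [_ [[h _]|[c [a [b [d [hcl [h1 h2 h3 h4]]]]]]]] := find_clawP e.
  by left; apply: modulatorS h.
have nm : ~ modulator (e rS) by move/(_ c a b d); rewrite hcl.
case/andP: (hcl) => _ /and4P[o1 o2 o3 o4]; rewrite h1 h2 h3 h4.
by case: (modulator_hits mT hcl) => hT; apply: (hit_good hg _ nm hT) => //; rewrite !inE eqxx ?orbT.
Qed.

Lemma branch_hitting : hitting branches.
Proof.
move=> e T k mT hg; have sS B : e rS \subset e rS :|: B by apply: subsetUl.
have [_ [[h _]|[c [a [b [d [hcl [h1 h2 h3 h4]]]]]]]] := find_clawP e.
  by exists 0 => //; rewrite [nth _ _ _]/= branch_sem //; left; apply: modulatorS h.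
have nm : ~ modulator (e rS) by move/(_ c a b d); rewrite hcl.
case/andP: (hcl) => _ /and4P[o1 o2 o3 o4].
case: (modulator_hits mT hcl) => hT; [exists 0 | exists 1 | exists 2 | exists 3] => //;
by rewrite [nth _ _ _]/= branch_sem // ?h1 ?h2 ?h3 ?h4; apply: (hit_good hg _ nm hT) => //;
  rewrite !inE eqxx ?orbT.
Qed.

Lemma check_claw_freeP e : 0 < #|G| -> reflect (modulator (e rS)) (csem check_claw_free e rF !=
  set0).
Proof.
move=> n0; have hf x : (x \in csem check_claw_free e rF) = ~~ fsem (FEx rc (FEx ra (FEx rb (FEx rd
  claw)))) (upd e vv [set x]).
  by rewrite inE.
have he x : reflect (modulator (e rS)) (x \in csem check_claw_free e rF).
  rewrite hf; apply: (iffP negP) => [h c a b d|h].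
    apply/negP => hc; apply: h; apply/fsemExP; exists c; apply/fsemExP; exists a; apply/fsemExP;
      exists b.
    by apply/fsemExP; exists d; rewrite (fsem_claw (c := c) (a := a) (b := b) (d := d)).
  move=> /fsemExP[c /fsemExP[a /fsemExP[b /fsemExP[d]]]].
  by rewrite (fsem_claw (c := c) (a := a) (b := b) (d := d)) //=; apply/negP; apply: h.
apply: (iffP (set0Pn _)) => [[x /he//]|h].
by case/card_gt0P: n0 => x _; exists x; apply/he.
Qed.

(** A block adds at most 4 + 1 + 1 + 1 + 1 = 8 vertices, and the test at the leaf certifies the
    modulator. *)
Lemma sched1_sound m e e' : 0 < #|G| -> reach (sched1 m) e e' -> e' rF != set0 ->
  [/\ modulator (e' rS), #|e' rS| <= #|e rS| + 8 * m, e' rL = e rL & e' rJ = e rJ].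
Proof.
move=> n0; elim: m e => [|m IH] e.
  case=> -[|//] _ <- h; split=> //; last by rewrite leq_addr.
  exact/check_claw_freeP.
case=> i0 /(pack_growing e); set e0 := csem _ e => -[h0 l0 j0].
case=> i1 /(branch_growing e0); set e1 := csem _ e0 => -[h1 l1 j1].
case=> i2 /(branch_growing e1); set e2 := csem _ e1 => -[h2 l2 j2].
case=> i3 /(branch_growing e2); set e3 := csem _ e2 => -[h3 l3 j3].
case=> i4 /(branch_growing e3); set e4 := csem _ e3 => -[h4 l4 j4].
move=> /IH{}IH /IH[hm hc -> ->]; split=> //; first by lia.
  by rewrite l4 l3 l2 l1 l0.
by rewrite j4 j3 j2 j1 j0.
Qed.

(** Each of the five levels of a block has an alternative gaining a vertex of [T]; after 5 m of them
    [T] is exhausted, unless a modulator was reached before. *)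
Lemma sched1_complete m e T : 0 < #|G| -> modulator T -> good T (5 * m) (e rS) ->
  exists2 e', reach (sched1 m) e e' & e' rF != set0.
Proof.
move=> n0 mT; elim: m e => [|m IH] e hg.
  exists (csem check_claw_free e); first by exists 0.
  apply/check_claw_freeP => //; case: hg => //; rewrite leqn0 cards_eq0 setD_eq0 => h.
  exact: modulatorS mT.
have [i0 h0] := pack_hitting mT hg; set e0 := csem _ e => g0.
have [i1 h1] := branch_hitting mT g0; set e1 := csem _ e0 => g1.
have [i2 h2] := branch_hitting mT g1; set e2 := csem _ e1 => g2.
have [i3 h3] := branch_hitting mT g2; set e3 := csem _ e2 => g3.
have [i4 h4] := branch_hitting mT g3; set e4 := csem _ e3 => g4.
have [|e' hr he'] := IH e4; first by case: g4 => g4; [left | right; move: g4; lia].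
by exists e' => //; exists i0 => //; exists i1 => //; exists i2 => //; exists i3 => //; exists i4.
Qed.
End Graph.

(** * 2-SAT by limited backtracking *)

Section TwoSat.
Variables (T : finType) (A R : rel T).
Hypotheses (symA : symmetric A) (symR : symmetric R).
Implicit Types (J : {set T}) (st : {set T} * {set T}).

(** A 2-SAT instance: [A] lists the clauses with two negative literals and [R] those with two
    positive ones. *)
Definition sol J := (forall x y, A x y -> x \in J -> y \notin J) /\
                    (forall x y, R x y -> x \notin J -> y \in J).

(** One round of unit propagation; a state holds the variables set to true and those set to false.
    The second component already uses the enlarged first one, as in [close]. *)
Definition sstep st : {set T} * {set T} :=
  let I := st.1 :|: [set v | [exists u, (u \in st.2) && R u v]] in
  (I, st.2 :|: [set v | [exists u, (u \in I) && A u v]]).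

Definition closure st := iter #|T| sstep st.

Definition conflict st := [exists x, (x \in st.1) && (x \in st.2)].

Definition tstep st x :=
  let st1 := closure (st.1 :|: [set x], st.2) in
  if conflict st1 then closure (st.1, st.2 :|: [set x]) else st1.

Definition below st st' := (st.1 \subset st'.1) && (st.2 \subset st'.2).

Definition ext J st := below st (J, ~: J).

Lemma below_refl st : below st st.
Proof. by rewrite /below !subxx. Qed.

Lemma below_trans st1 st2 st3 : below st1 st2 -> below st2 st3 -> below st1 st3.
Proof. by move=> /andP[h1 h2] /andP[h3 h4];
  rewrite /below (subset_trans h1) ?(subset_trans h2). Qed.

Lemma below_sstep st : below st (sstep st).
Proof. by rewrite /below !subsetUl. Qed.

Lemma below_iter k st : below st (iter k sstep st).
Proof. by elim: k => [|k IH]; [apply: below_refl | apply: below_trans IH (below_sstep _)]. Qed.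

Lemma ext_sstep J st : sol J -> ext J st -> ext J (sstep st).
Proof.
move=> [hA hR] /andP[/subsetP h1 /subsetP h2].
have hI : (sstep st).1 \subset J.
  apply/subsetP => v; rewrite !inE => /orP[/h1//|/existsP[u /andP[/h2]]].
  by rewrite inE => hu /hR; apply.
rewrite /ext /below hI; apply/subsetP => v; rewrite in_setU => /orP[/h2//|].
by rewrite inE => /existsP[u /andP[/(subsetP hI) hu /hA/(_ hu)]]; rewrite inE.
Qed.

Lemma ext_closure J st : sol J -> ext J st -> ext J (closure st).
Proof. by move=> hs h; rewrite /closure; elim: #|T| => //= k; apply: ext_sstep. Qed.

Lemma ext_conflict J st : ext J st -> ~~ conflict st.
Proof.
move=> /andP[/subsetP h1 /subsetP h2]; apply/existsP => -[x /andP[/h1 xJ /h2]].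
by rewrite /= inE xJ.
Qed.

Definition weight st := #|st.1| + #|st.2|.

Lemma weight_sstep st : sstep st <> st -> weight st < weight (sstep st).
Proof.
move=> ne; have /andP[h1 h2] := below_sstep st; rewrite /weight.
have l1 := subset_leq_card h1; have l2 := subset_leq_card h2.
rewrite ltn_neqAle leq_add // andbT; apply/eqP => E; apply: ne.
have [e1 e2] : #|st.1| = #|(sstep st).1| /\ #|st.2| = #|(sstep st).2|.
  move: E l1 l2; move: #|st.1| #|st.2| #|(sstep st).1| #|(sstep st).2| => a b c d; lia.
rewrite [RHS]surjective_pairing [LHS]surjective_pairing.
congr (_, _); apply/esym/eqP; rewrite eqEcard ?h1 ?h2 /=.
  by rewrite e1.
by rewrite e2.
Qed.

(* A conflict-free state has weight at most #|T|, and every pass before stabilisation adds an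
   element. *)
Lemma closure_closed st : 0 < weight st -> ~~ conflict (closure st) ->
  sstep (closure st) = closure st.
Proof.
move=> w0 nc; have key k : sstep (iter k sstep st) = iter k sstep st \/ k + weight st <= weight
  (iter k sstep st).
  elim: k => [|k IH]; first by right.
  have [E|/eqP ne] := eqVneq (sstep (iter k sstep st)) (iter k sstep st); first by left;
    rewrite /= !E.
  right; case: IH => [//|IH]; rewrite addSn; apply: leq_ltn_trans IH _; exact: weight_sstep.
have [//|] := key #|T|; rewrite -/(closure st) => h.
have : weight (closure st) <= #|T|.
  rewrite /weight -cardsUI; have -> : (closure st).1 :&: (closure st).2 = set0.
    by apply/setP => x; rewrite !inE; apply: contraNF nc => hx; apply/existsP; exists x.
  by rewrite cards0 addn0 max_card.
by move: h w0; move: #|T| (weight _) (weight _) => a b c; lia.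
Qed.

(** Why a propagated choice without conflict never has to be undone: overriding any solution by a
    closed conflict-free assignment gives a solution, as each clause touching an assigned variable
    is satisfied by it or by the propagated value of the other variable. *)
Lemma sol_swap J st : sol J -> ~~ conflict st -> sstep st = st -> sol ((J :\: st.2) :|: st.1).
Proof.
move=> [hA hR] nc cl.
have dj x : x \in st.1 -> x \notin st.2.
  by move=> h1; apply: contraNN nc => h2; apply/existsP; exists x; rewrite h1.
have cI u v : u \in st.2 -> R u v -> v \in st.1.
  by move=> h1 h2; rewrite -cl !inE; apply/orP; right; apply/existsP; exists u; rewrite h1.
have cC u v : u \in st.1 -> A u v -> v \in st.2.
  move=> h1 h2; rewrite -cl in_setU inE; apply/orP; right; apply/existsP; exists u;
    rewrite h2 andbT.
  by rewrite in_setU h1.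
split=> x y.
  move=> hxy; rewrite !inE => /orP[/andP[x2 xJ]|x1]; rewrite negb_or negb_and negbK.
    have ny : y \notin st.1 by apply: contraNN x2 => y1; apply: cC y1 _; rewrite symA.
    by rewrite ny andbT; apply/orP; right; apply: hA hxy xJ.
  have y2 := cC _ _ x1 hxy; rewrite y2 /=.
  by apply/negP => /dj; rewrite y2.
move=> hxy; rewrite !inE negb_or negb_and negbK => /andP[/orP[x2|xJ] x1].
  by rewrite (cI _ _ x2 hxy) orbT.
have [y2|y2 /=] := boolP (y \in st.2); last by rewrite (hR _ _ hxy xJ).
by move: x1; rewrite (cI y x y2) // symR.
Qed.

(** If setting [x] to true leads to a conflict, [x] is false in [J], so [J] itself extends the other
    branch. Otherwise [sol_swap] turns [J] into a solution extending the first branch. *)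
Lemma tstepP J st x : sol J -> ext J st ->
  below st (tstep st x) /\ x \in (tstep st x).1 :|: (tstep st x).2 /\
  exists2 J', sol J' & ext J' (tstep st x).
Proof.
move=> hs he; rewrite /tstep; set s1 := (st.1 :|: _, _); set s2 := (_, st.2 :|: _).
have b1 : below st s1 by rewrite /below /= subsetUl subxx.
have b2 : below st s2 by rewrite /below /= subsetUl subxx.
have c1 := below_iter #|T| s1; have c2 := below_iter #|T| s2.
have x1 : x \in (closure s1).1 :|: (closure s1).2.
  by case/andP: c1 => /subsetP h _; rewrite inE h // !inE eqxx orbT.
have x2 : x \in (closure s2).1 :|: (closure s2).2.
  by case/andP: c2 => _ /subsetP h; rewrite inE (h x) ?orbT // !inE eqxx orbT.
have d1 : below st (closure s1) := below_trans b1 c1.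
have d2 : below st (closure s2) := below_trans b2 c2.
case: ifP => hc; (split; [by [] | split; first by []]).
  have xJ : x \notin J.
    apply/negP => xJ; move: hc; apply/negP; apply: (@ext_conflict J); apply: ext_closure => //.
    by case/andP: he => h1 h2; rewrite /ext /below /= subUset h1 h2 sub1set xJ.
  exists J => //; apply: ext_closure => //; case/andP: he => h1 h2.
  by rewrite /ext /below /= subUset h1 h2 sub1set inE xJ.
have w0 : 0 < weight s1.
  by rewrite /weight /= addn_gt0; apply/orP; left; apply/card_gt0P; exists x;
    rewrite !inE eqxx orbT.
have cl := closure_closed w0 (negbT hc).
exists ((J :\: (closure s1).2) :|: (closure s1).1); first exact: sol_swap (negbT hc) cl.
rewrite /ext /below /= subsetUr; apply/subsetP => y hy; rewrite !inE hy /=.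
by apply: contraFN hc => h; apply/existsP; exists y; rewrite h.
Qed.

Lemma twosat_complete J : sol J -> sol (foldl tstep (set0, set0) (enum T)).1.
Proof.
move=> hs; set st0 := (set0, set0).
have [K hK] : exists2 J', sol J' & ext J' st0 by exists J => //; rewrite /ext /below /= !sub0set.
have key s st J' : sol J' -> ext J' st -> let st' := foldl tstep st s in
    [/\ below st st', {in s, forall x, x \in st'.1 :|: st'.2} & exists2 J'', sol J'' & ext J'' st'].
  elim: s st J' => [|x s IH] st J' h1 h2 /=; first by split; [exact: below_refl | | exists J'].
  have [b1 [x1 [J2 hJ2 e2]]] := tstepP x h1 h2; have [b2 a2 e3] := IH _ _ hJ2 e2.
  split=> //; first exact: below_trans b2.
  move=> y; rewrite inE => /orP[/eqP->|]; last exact: a2.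
  by case/andP: b2 => /subsetP h3 /subsetP h4; move: x1; rewrite !inE => /orP[/h3->|/h4->//];
    rewrite ?orbT.
move=> hE; have [_ a [J2 hJ2 /andP[/subsetP h1 /subsetP h2]]] := key (enum T) st0 K hK hE.
(* Every variable has been assigned by now, so the solution extending the final state is its first
   component. *)
suff -> : (foldl tstep st0 (enum T)).1 = J2 by [].
apply/setP => x; apply/idP/idP => [/h1//|xJ].
have xe : x \in enum T by rewrite mem_enum.
by have := a x xe; rewrite in_setU => /orP[//|/h2]; rewrite inE xJ.
Qed.
End TwoSat.

(** * Monopolar partitions as solutions of 2-clauses *)

Section Solve.
Variable G : graph.
Implicit Types (x y z u v w a b c d t : G) (A B I C J K S : {set G}) (e : nat -> {set G}).
Arguments upd G e i A j /.

Definition diamond v := [exists x, exists y, exists z, [&& adj v x, adj v y, adj v z & p3 x y z]].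
Definition paw v u := [exists w, exists w', [&& adj w w', adj v w', p3 u v w & ~~ adj u w']].
Definition forced S J := [set v | (v \in S) && (v \notin J) || [exists y, adj v y && (y \in J)] ||
  diamond v].
Definition relA K : rel G := fun x y => adj x y || (x == y) && (x \in K).
Definition relR J K : rel G := fun x y =>
  [|| (x == y) && (x \in J),
      [exists a, (a \in K) && [|| p3 a x y, p3 x a y | p3 x y a]], paw x y | paw y x].

Lemma p3C x y z : p3 x y z = p3 z y x.
Proof.
by rewrite /p3 (adj_sym x y) (adj_sym y z) (adj_sym x z) (eq_sym x z); case: adj; case: adj.
Qed.

Lemma relA_sym K : symmetric (relA K).
Proof. by move=> x y; rewrite /relA adj_sym; case: (x =P y) => [->|/nesym/eqP/negPf->];
  rewrite ?eqxx. Qed.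

Lemma relR_sym J K : symmetric (relR J K).
Proof.
move=> x y; rewrite /relR; congr [|| _, _ | _]; last by rewrite orbC.
  by case: (x =P y) => [->|/nesym/eqP/negPf->]; rewrite ?eqxx.
apply: eq_existsb => a; congr (_ && _); rewrite (p3C a x y) (p3C x a y) (p3C x y a).
by rewrite orbA orbC orbCA orbC -orbA.
Qed.

Definition p3_free C := forall x y z, x \in C -> y \in C -> z \in C -> ~~ p3 x y z.

(** A vertex of [J] has all its neighbours outside [J], so they contain no induced path and the
    vertex has no degree 3 in a diamond; hence [K] avoids [J]. In a paw with [u] and [v] outside
    [J], the path u - v - w puts [w] into [J], hence w' outside, and then u - v - w' is a forbidden
    path. *)
Lemma sol_of_partition S J : independent J -> p3_free (~: J) ->
  let J0 := S :&: J in let K := forced S J0 in sol (relA K) (relR J0 K) J.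
Proof.
move=> ind pf J0 K.
have indE x y : adj x y -> x \in J -> y \notin J.
  by move=> h xJ; apply/negP => yJ; move: (ind x y xJ yJ); rewrite h.
have nK x : x \in K -> x \notin J.
  rewrite !inE => /orP[/orP[/andP[xS]|/existsP[y /andP[hxy]]]|].
  - by rewrite xS.
  - by rewrite inE => /andP[_]; apply: indE; rewrite adj_sym.
  case/existsP=> a /existsP[b /existsP[c /and4P[ha hb hc h]]]; apply/negP => xJ.
  by move: h; apply/negP; apply: pf; rewrite inE; apply: indE xJ.
have pfE x y z : p3 x y z -> x \notin J -> y \notin J -> z \notin J -> False.
  by move=> h hx hy hz; move: h; apply/negP; apply: pf; rewrite inE.
have pawE v u : paw v u -> v \notin J -> u \notin J -> False.
  case/existsP=> w /existsP[w' /and4P[h1 h2 h3 h4]] vJ uJ.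
  have [wJ|wJ] := boolP (w \in J); last exact: pfE h3 uJ vJ wJ.
  have w'J := indE _ _ h1 wJ; apply: (pfE u v w') => //; case/and4P: h3 => h5 h6 h7 h8.
  rewrite /p3 h5 h2 h4 /=; apply: contraNneq h7 => ->; by rewrite adj_sym.
split=> x y.
  by case/orP; [exact: indE | case/andP=> _ /nK/negPf->].
case/or4P=> [/andP[_ xJ0]|/existsP[a /andP[/nK aJ h]]|h|h] xJ.
- by move: xJ0; rewrite inE (negPf xJ) andbF.
- have [//|yJ] := boolP (y \in J); exfalso.
  by case/or3P: h => h; [apply: pfE h aJ xJ yJ | apply: pfE h xJ aJ yJ | apply: pfE h xJ yJ aJ].
- by have [//|yJ] := boolP (y \in J); case: (pawE _ _ h xJ yJ).
by have [//|yJ] := boolP (y \in J); case: (pawE _ _ h yJ xJ).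
Qed.

(* For an induced path u - v - w avoiding I, maximality yields a neighbour t of v in I outside S;
   the claw {v; u, w, t} being excluded, {u, v, w, t} induces a diamond or a paw, and both
   are ruled out by the clauses. *)
Lemma partition_of_sol S J0 I : J0 \subset S -> modulator S ->
  let K := forced S J0 in sol (relA K) (relR J0 K) I ->
  (forall x, x \notin I -> x \notin K -> exists2 y, adj x y & y \in I) ->
  independent I /\ p3_free (~: I).
Proof.
move=> /subsetP sJ mS K [hA hR] mx; split.
  by move=> x y xI yI; apply: contraL yI => h; apply: hA xI; rewrite /relA h.
move=> u v w; rewrite !inE => uI vI wI; apply/negP => h.
have KI x : x \in K -> x \notin I.
  by move=> xK; apply/negP => xI; move: (hA x x); rewrite /relA eqxx xK orbT xI => /(_ isT isT).
have kill a x y : a \in K -> x \notin I -> y \notin I -> ~~ [|| p3 a x y, p3 x a y | p3 x y a].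
  move=> aK xI yI; apply: contraNN yI => hp; apply: (hR x y) => //.
  by apply/or4P; constructor 2; apply/existsP; exists a; rewrite aK.
have uK : u \notin K by apply: contraTN h => uK; have := kill _ _ _ uK vI wI;
  rewrite negb_or => /andP[].
have vK : v \notin K by apply: contraTN h => vK; have := kill _ _ _ vK uI wI;
  rewrite !negb_or => /and3P[].
have wK : w \notin K by apply: contraTN h => wK; have := kill _ _ _ wK uI vI;
  rewrite !negb_or => /and3P[].
have inS x : x \in S -> x \notin I -> x \in K.
  move=> xS xI; rewrite inE xS /=; case: (boolP (x \in J0)) => //= xJ.
  by move: (hR x x); rewrite /relR eqxx xJ (negPf xI) => /(_ isT isT).
have [t vt tI] := mx v vI vK.
(* A neighbour of [v] in [J0] would force [v] into [K], and the vertices of [S] outside [J0] lie in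
   [K], hence outside [I]. *)
have tS : t \notin S.
  apply/negP => tS; have [tJ|tJ] := boolP (t \in J0).
    by move: vK; rewrite inE !negb_or => /andP[/andP[_ /existsP[]]]; exists t; rewrite vt.
  by have := KI t; rewrite inE tS tJ tI => /(_ isT).
case/and4P: (h) => uv vw nuw uw.
have ut : u != t by apply: contraNneq uI => ->.
have wt : w != t by apply: contraNneq wI => ->.
have oS x : x \notin I -> x \notin K -> x \notin S by move=> xI; apply: contraNN => xS; apply: inS.
have pawR x y : paw x y -> x \notin I -> y \notin I -> False.
  by move=> hp xI /negP; apply; apply: (hR x y) => //; rewrite /relR hp !orbT.
have := mS v u w t; rewrite /claw_out /claw_at (adj_sym v u) uv vw vt nuw uw ut wt.
rewrite (oS u uI uK) (oS v vI vK) (oS w wI wK) tS /= !andbT.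
rewrite negb_and !negbK; case: (boolP (adj u t)) => hut; case: (boolP (adj w t)) => hwt //= _.
- move: vK; rewrite inE !negb_or => /andP[_ /existsP[]]; exists u; apply/existsP; exists t.
  by apply/existsP; exists w; rewrite (adj_sym v u) uv vt vw /p3 hut (adj_sym t w) hwt nuw uw.
- apply: (pawR v w) => //; apply/existsP; exists u; apply/existsP; exists t.
  by rewrite hut vt p3C h hwt.
apply: (pawR v u) => //; apply/existsP; exists w; apply/existsP; exists t.
by rewrite hwt vt h hut.
Qed.

Definition mstep K I x := if (x \notin K) && ~~ [exists y, adj x y && (y \in I)] then x |: I else I.

(** Adding vertices keeps the positive clauses, and a vertex is added only if it violates no
    negative one. A vertex outside [K] rejected at its turn keeps its neighbour, since the set only
    grows. *)
Lemma maximal_extension J0 K I : sol (relA K) (relR J0 K) I ->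
  let I' := foldl (mstep K) I (enum G) in
  sol (relA K) (relR J0 K) I' /\
  (forall x, x \notin I' -> x \notin K -> exists2 y, adj x y & y \in I').
Proof.
move=> hs; have key s I0 : sol (relA K) (relR J0 K) I0 -> let I' := foldl (mstep K) I0 s in
    [/\ sol (relA K) (relR J0 K) I', I0 \subset I' &
     {in s, forall x, x \notin I' -> x \notin K -> exists2 y, adj x y & y \in I'}].
  elim: s I0 => [|x s IH] I0 h0 /=; first by [].
  have h1 : sol (relA K) (relR J0 K) (mstep K I0 x).
    rewrite /mstep; case: ifP => // /andP[xK /existsPn hx]; case: h0 => hA hR; split=> a b hab.
      rewrite !inE => /orP[/eqP ax|aI]; rewrite negb_or.
        subst a; move: hab; rewrite /relA (negPf xK) andbF orbF => hab.
        have := hx b; rewrite hab /= => ->; rewrite andbT; apply/eqP => bx.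
        by rewrite bx adj_irr in hab.
      rewrite (hA a b hab aI) andbT; apply/eqP => bx; subst b.
      move: hab; rewrite relA_sym /relA (negPf xK) andbF orbF => hab.
      by have := hx a; rewrite hab aI.
    by rewrite !inE !negb_or => /andP[_ /(hR _ _ hab)->]; rewrite orbT.
  have s1 : I0 \subset mstep K I0 x by rewrite /mstep; case: ifP => // _; apply: subsetUr.
  have [h2 s2 m2] := IH _ h1; split=> //; first exact: subset_trans s2.
  move=> y; rewrite inE => /orP[/eqP-> xI xK|]; last exact: m2.
  have xm : x \notin mstep K I0 x by apply: contraNN xI; apply: (subsetP s2).
  have [z h3 h4] : exists2 z, adj x z & z \in I0.
    move: xm; rewrite /mstep xK /=; case: ifP => [_|/negbFE/existsP[z /andP[h3 h4]] _].
      by rewrite !inE eqxx.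
    by exists z.
  by exists z; [exact: h3 | exact: (subsetP s2 _ (subsetP s1 _ h4))].
have [h1 _ h2] := key (enum G) I hs; split=> // x; apply: h2; exact: mem_enum.
Qed.

(** * Semantics of the solver commands *)

Lemma fsem_relA e x y : e vu = [set x] -> e vv = [set y] -> fsem (relAF vu vv) e = relA (e rK) x y.
Proof.
move=> hx hy; rewrite fsemOr fsemAnd (fsemAdj hx hy) (fsemMeet vv hx) (fsemMeet rK hx) hy inE.
by [].
Qed.

Lemma fsem_paw e i j x y : (i, j) = (vu, vv) \/ (i, j) = (vv, vu) ->
  e i = [set x] -> e j = [set y] -> fsem (pawF i j) e = paw x y.
Proof.
move=> hij hx hy; apply/fsemExP/existsP => -[a ha]; exists a; [apply/existsP | apply/fsemExP];
  [case/fsemExP: ha | case/existsP: ha] => b hb; exists b; move: hb;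
  case: hij hx hy => -[-> ->] hx hy;
  rewrite 3!fsemAnd fsemNot (@fsemAdj _ _ ra rb a b) // (@fsemAdj _ _ _ rb x b) //
    (@fsemAdj _ _ _ rb y b) // (@fsem_p3 _ _ _ _ ra y x a) //; by rewrite !andbA.
Qed.

Lemma fsem_relR e x y : e vu = [set x] -> e vv = [set y] ->
  fsem (relRF vu vv) e = relR (e rJ) (e rK) x y.
Proof.
move=> hx hy; rewrite !fsemOr fsemAnd (fsemMeet vv hx) (fsemMeet rJ hx) hy inE.
rewrite (fsem_paw _ hx hy) ?(fsem_paw _ hy hx); [|by right|by left].
congr [|| _, _ | _]; apply/fsemExP/existsP => -[a ha]; exists a; move: ha;
by rewrite fsemAnd !fsemOr (@fsemMeet _ _ ra rK a) // (@fsem_p3 _ _ _ _ _ a x y) //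
  (@fsem_p3 _ _ _ _ _ x a y) // (@fsem_p3 _ _ _ _ _ x y a).
Qed.

Lemma force_sem e : csem force e rK = forced (e rS) (e rJ).
Proof.
change (csem force e rK) with (comp e vv (FOr (FAnd (FMeet vv rS) (FNot (FMeet vv rJ)))
                                             (FOr (FAdj vv rJ) (diamondF vv)))).
apply/setP => v; rewrite !in_set !fsemOr fsemAnd fsemNot !(@fsemMeet _ _ _ _ v) //.
rewrite (@fsemAdjS _ _ _ _ v) // -orbA; congr [|| _, _ | _].
apply/fsemExP/existsP => -[x hx]; exists x; [apply/existsP | apply/fsemExP];
  [case/fsemExP: hx | case/existsP: hx] => y hy; exists y; [apply/existsP | apply/fsemExP];
  [case/fsemExP: hy | case/existsP: hy] => z hz; exists z; move: hz;
by rewrite 3!fsemAnd (@fsemAdj _ _ _ _ v x) // (@fsemAdj _ _ _ _ v y) // (@fsemAdj _ _ _ _ v z) //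
   (@fsem_p3 _ _ _ _ _ x y z) // -!andbA.
Qed.

Lemma upd_neq e i A j : j != i -> upd e i A j = e j.
Proof. by rewrite /upd eqnE => /negPf->. Qed.

Lemma upd_eq e i A : upd e i A i = A.
Proof. by rewrite /upd eqnE eqxx. Qed.

Lemma comp_relR e i k : i < vu -> k < vu -> comp e vv (FOr (FMeet vv i) (FEx vu (FAnd (FMeet vu k)
  (relRF vu vv)))) =
  e i :|: [set v | [exists u, (u \in e k) && relR (e rJ) (e rK) u v]].
Proof.
move=> hi hk; have [n1 n2 n3] : [/\ i != vv, k != vv & k != vu] by split; lia.
apply/setP => v; rewrite in_setU !in_set fsemOr (@fsemMeet _ _ _ _ v) // upd_neq //; congr (_ || _).
by apply/fsemExP/existsP => -[u hu]; exists u; move: hu; rewrite fsemAnd (@fsemMeet _ _ _ _ u) //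
  (@fsem_relR _ u v) // !upd_neq.
Qed.

Lemma comp_relA e i k : i < vu -> k < vu -> comp e vv (FOr (FMeet vv k) (FEx vu (FAnd (FMeet vu i)
  (relAF vu vv)))) =
  e k :|: [set v | [exists u, (u \in e i) && relA (e rK) u v]].
Proof.
move=> hi hk; have [n1 n2 n3] : [/\ k != vv, i != vv & i != vu] by split; lia.
apply/setP => v; rewrite in_setU !in_set fsemOr (@fsemMeet _ _ _ _ v) // upd_neq //; congr (_ || _).
by apply/fsemExP/existsP => -[u hu]; exists u; move: hu; rewrite fsemAnd (@fsemMeet _ _ _ _ u) //
  (@fsem_relA _ u v) // !upd_neq.
Qed.

(** The bounds place [i] and [k] among the registers of partial assignments, away from the bound
    variables and from [rJ] and [rK], so the clauses stay the same during the loop. *)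
Lemma close_sem i k e : i < vx -> rK < i -> k < vx -> rK < k -> i != k ->
  let e' := csem (close i k) e in
  (e' i, e' k) = closure (relA (e rK)) (relR (e rJ) (e rK)) (e i, e k) /\
  (forall j, j \notin [:: i; k; vy] -> e' j = e j).
Proof.
move=> h1 h2 h3 h4 ik; rewrite /closure cardE.
change (csem (close i k) e) with (foldl (fun e x => csem
  (CSeq (CSet i vv (FOr (FMeet vv i) (FEx vu (FAnd (FMeet vu k) (relRF vu vv)))))
        (CSet k vv (FOr (FMeet vv k) (FEx vu (FAnd (FMeet vu i) (relAF vu vv)))))) (upd e vy [set
          x])) e (enum G)).
elim: (enum G) e => [|x s IH] e //.
rewrite [foldl _ _ _]/= [size _]/= iterSr.
set e0 := upd e vy _; set e1 := upd e0 i _; set e2 := upd e1 k _.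
have hi : e1 i = (sstep (relA (e rK)) (relR (e rJ) (e rK)) (e i, e k)).1.
  by rewrite /e1 upd_eq comp_relR ?/e0 ?upd_neq //; lia.
have hk : e2 k = (sstep (relA (e rK)) (relR (e rJ) (e rK)) (e i, e k)).2.
  rewrite /e2 upd_eq comp_relA; [|lia|lia]; rewrite hi /e1 /e0 !upd_neq //; lia.
have oth j : j \notin [:: i; k; vy] -> e2 j = e j.
  by rewrite !inE !negb_or => /and3P[n1 n2 n3]; rewrite /e2 /e1 /e0 !upd_neq.
have hi2 : e2 i = e1 i by rewrite /e2 upd_neq.
have eK : e2 rK = e rK by apply: oth; rewrite !inE; lia.
have eJ : e2 rJ = e rJ by apply: oth; rewrite !inE; lia.
have [E1 E2] := IH e2; split; last by move=> j hj; rewrite E2 // oth.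
by rewrite E1 eK eJ hi2 hi hk -surjective_pairing.
Qed.

Lemma compU1 e i j : i < vv -> j < vv -> comp e vv (FOr (FMeet vv i) (FMeet vv j)) = e i :|: e j.
Proof. by move=> hi hj; apply: compU; lia. Qed.

Lemma comp1 e i : i < vv -> comp e vv (FMeet vv i) = e i.
Proof.
by move=> hi; apply/setP => x; rewrite in_set (@fsemMeet _ _ _ _ x) // upd_neq //; lia.
Qed.

Lemma choose_sem e r r1 r2 : r1 < vv -> r2 < vv ->
  csem (choose r r1 r2) e = upd e r (if conflict (e rI1, e rC1) then e r2 else e r1).
Proof.
move=> h1 h2; rewrite /=; congr upd; apply/setP => x.
rewrite in_set fsemOr !fsemAnd fsemNot -[fsem (FMeet rI1 rC1) _]/(conflict (e rI1, e rC1)).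
rewrite !(@fsemMeet _ _ _ _ x) // !upd_neq; [|lia|lia].
by case: conflict; rewrite /= ?orbF.
Qed.

Lemma twosat_sem e : let e' := csem twosat_step e in
  (forall x, e vx = [set x] ->
   (e' rI, e' rC) = tstep (relA (e rK)) (relR (e rJ) (e rK)) (e rI, e rC) x) /\
  [/\ e' rS = e rS, e' rJ = e rJ & e' rK = e rK].
Proof.
pose e1 := csem (CSeq (CSet rI1 vv (FOr (FMeet vv rI) (FMeet vv vx))) (CSet rC1 vv (FMeet vv rC)))
  e.
pose e2 := csem (close rI1 rC1) e1.
pose e3 := csem (CSeq (CSet rI2 vv (FMeet vv rI)) (CSet rC2 vv (FOr (FMeet vv rC) (FMeet vv vx))))
  e2.
pose e4 := csem (close rI2 rC2) e3.
pose e5 := csem (choose rI rI1 rI2) e4.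
move=> e'; have {e'}-> : e' = csem (choose rC rC1 rC2) e5 by [].
have [I1 o1] : (e1 rI1, e1 rC1) = (e rI :|: e vx, e rC) /\ (forall j, j \notin [:: rI1;
  rC1] -> e1 j = e j).
  split; last by move=> j; rewrite !inE !negb_or => /andP[n1 n2];
    rewrite /e1 /= !eqnE (negPf n1) (negPf n2).
  by rewrite /e1 /= -[LHS]/(comp _ _ _, comp _ _ _) compU1 // comp1.
have [I2 o2] : (e2 rI1, e2 rC1) = closure (relA (e1 rK)) (relR (e1 rJ) (e1 rK)) (e1 rI1, e1 rC1) /\
   (forall j, j \notin [:: rI1; rC1; vy] -> e2 j = e1 j) by apply: close_sem.
have [I3 o3] : (e3 rI2, e3 rC2) = (e2 rI, e2 rC :|: e2 vx) /\ (forall j, j \notin [:: rI2;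
  rC2] -> e3 j = e2 j).
  split; last by move=> j; rewrite !inE !negb_or => /andP[n1 n2];
    rewrite /e3 /= !eqnE (negPf n1) (negPf n2).
  by rewrite /e3 /= -[LHS]/(comp _ _ _, comp _ _ _) compU1 // comp1.
have [I4 o4] : (e4 rI2, e4 rC2) = closure (relA (e3 rK)) (relR (e3 rJ) (e3 rK)) (e3 rI2, e3 rC2) /\
   (forall j, j \notin [:: rI2; rC2; vy] -> e4 j = e3 j) by apply: close_sem.
have [I5 o5] : e5 rI = (if conflict (e4 rI1, e4 rC1) then e4 rI2 else e4 rI1) /\
    (forall j, j != rI -> e5 j = e4 j).
  by rewrite /e5 choose_sem //; split=> // j hj; rewrite upd_neq.
clearbody e1 e2 e3 e4 e5; rewrite choose_sem //; split; last first.
  by rewrite !upd_neq // !o5 // !o4 // !o3 // !o2 // !o1.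
move=> x hx; rewrite upd_eq upd_neq // I5 !o5 // /tstep.
have q1 : (e4 rI1, e4 rC1) = closure (relA (e rK)) (relR (e rJ) (e rK)) (e rI :|: [set x], e rC).
  by rewrite !o4 // !o3 // I2 I1 !o1 // hx.
have q2 : (e4 rI2, e4 rC2) = closure (relA (e rK)) (relR (e rJ) (e rK)) (e rI, e rC :|: [set x]).
  by rewrite I4 I3 !o3 // !o2 // !o1 // hx.
rewrite [(e rI, e rC).1]/= [(e rI, e rC).2]/= -q1 -q2; by case: conflict.
Qed.

Lemma twosat_for_sem e : let e' := csem (CFor vx twosat_step) e in
  (e' rI, e' rC) = foldl (tstep (relA (e rK)) (relR (e rJ) (e rK))) (e rI, e rC) (enum G) /\
  [/\ e' rS = e rS, e' rJ = e rJ & e' rK = e rK].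
Proof.
pose F e x := csem twosat_step (upd e vx [set x]).
change (csem (CFor vx twosat_step) e) with (foldl F e (enum G)).
elim: (enum G) e => [|x s IH] e //; cbv zeta.
change (foldl F e (x :: s)) with (foldl F (F e x) s).
change (foldl ?f ?z (x :: s)) with (foldl f (f z x) s).
have [/(_ x (upd_eq _ _ _)) hx [hS hJ hK]] := twosat_sem (upd e vx [set x]).
rewrite -/(F e x) in hx hS hJ hK.
have [E [-> -> ->]] := IH (F e x); rewrite hS hJ hK in E *; split=> //.
by rewrite E hx.
Qed.
End Solve.

(** * The solver as a whole, and the guess of its labels *)

Section Labelling.
Variable G : graph.
Implicit Types (x y z u v w a b c d t : G) (A B I C J K S : {set G}) (e : nat -> {set G}).

Lemma maximalize_sem e : let e' := csem maximalize e in
  e' rI = foldl (mstep (e rK)) (e rI) (enum G).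
Proof.
pose c := CSet rI vv (FOr (FMeet vv rI)
  (FAnd (FMeet vv vx) (FNot (FOr (FMeet vx rK) (FAdj vx rI))))).
pose F e x := csem c (upd e vx [set x]).
cbv zeta; change (csem maximalize e) with (foldl F e (enum G)).
elim: (enum G) e => [|x s IH] e //.
change (foldl F e (x :: s)) with (foldl F (F e x) s).
change (foldl ?f ?z (x :: s)) with (foldl f (f z x) s).
rewrite IH; have -> : F e x rK = e rK by [].
congr foldl; apply/setP => v.
change (F e x rI) with (comp (upd e vx [set x]) vv (FOr (FMeet vv rI)
  (FAnd (FMeet vv vx) (FNot (FOr (FMeet vx rK) (FAdj vx rI)))))).
rewrite in_set fsemOr fsemAnd fsemNot fsemOr !(@fsemMeet _ _ vv _ v) //.
rewrite (@fsemMeet _ _ vx _ x) // (@fsemAdjS _ _ vx _ x) // /upd /= inE /mstep negb_or.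
by case: ifP => _; rewrite ?inE ?andbT ?andbF ?orbF // orbC.
Qed.

Lemma check_partitionP e : 0 < #|G| ->
  reflect (independent (e rI) /\ p3_free (e rC)) (csem check_partition e rF != set0).
Proof.
move=> n0; set f := FOr (FAdj rI rI) (FEx ra (FEx rb (FEx rd
    (FAnd (FAnd (FMeet ra rC) (FAnd (FMeet rb rC) (FMeet rd rC))) (p3F ra rb rd))))).
have hf x : (x \in csem check_partition e rF) = ~~ fsem f (upd e vv [set x]).
  by rewrite -fsemNot; change (csem check_partition e rF) with (comp e vv (FNot f)); rewrite in_set.
have he x : reflect (independent (e rI) /\ p3_free (e rC)) (x \in csem check_partition e rF).
  rewrite hf fsemOr negb_or; apply: (iffP andP) => -[h1 h2]; split.
  - move=> y z yI zI; apply: contraNN h1 => h; apply/existsP; exists y; rewrite yI.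
    by apply/existsP; exists z; rewrite h.
  - move=> a b c ha hb hc; apply: contraNN h2 => h.
    apply/fsemExP; exists a; apply/fsemExP; exists b; apply/fsemExP; exists c.
    rewrite 3!fsemAnd (@fsem_p3 _ _ _ _ _ a b c) // h andbT.
    by rewrite (@fsemMeet _ _ ra _ a) // (@fsemMeet _ _ rb _ b) // (@fsemMeet _ _ rd _ c) //
      !upd_neq // ha hb hc.
  - apply/negP => /existsP[y /andP[hy /existsP[z /andP[hyz hz]]]].
    by move: (h1 y z hy hz); rewrite hyz.
  apply/negP => /fsemExP[a /fsemExP[b /fsemExP[c]]].
  rewrite 3!fsemAnd (@fsem_p3 _ _ _ _ _ a b c) // (@fsemMeet _ _ ra _ a) // (@fsemMeet _ _ rb _ b)
    //.
  rewrite (@fsemMeet _ _ rd _ c) // !upd_neq // => /andP[/and3P[ha hb hc] h].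
  by move: (h2 a b c ha hb hc); rewrite h.
apply: (iffP (set0Pn _)) => [[x /he//]|h].
by case/card_gt0P: n0 => x _; exists x; apply/he.
Qed.

Definition complement := CSet rC vv (FNot (FMeet vv rI)).

Lemma complement_sem e : csem complement e rC = ~: e rI.
Proof.
change (csem complement e rC) with (comp e vv (FNot (FMeet vv rI))).
by apply/setP => x; rewrite !in_set fsemNot (@fsemMeet _ _ _ _ x) // upd_neq.
Qed.

Lemma empty_sem e r : csem (empty_set r) e = upd e r set0.
Proof.
rewrite -[LHS]/(upd e r (comp e vv _)); congr upd; apply/setP => x.
by rewrite in_set fsemNot (@fsemMeet _ _ _ _ x) // upd_eq set11 inE.
Qed.

Lemma solve_sound e : 0 < #|G| -> let e' := csem solve e in e' rF != set0 ->
  [/\ e' rC = ~: e' rI, independent (e' rI) & p3_free (e' rC)].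
Proof.
move=> n0; set e1 := csem maximalize (csem (CFor vx twosat_step)
   (csem (empty_set rC) (csem (empty_set rI) (csem force e)))).
cbv zeta; change (csem solve e) with (csem check_partition (csem complement e1)).
move/(check_partitionP _ n0) => [h1 h2].
by split=> //; exact: complement_sem.
Qed.

(** A monopolar partition agreeing with the guess makes the clauses satisfiable. The solver then
    finds some solution, perhaps not [J], and its maximal extension yields a partition that passes
    the check. *)
Lemma solve_complete e J : 0 < #|G| -> independent J -> p3_free (~: J) ->
  modulator (e rS) -> e rJ = e rS :&: J -> csem solve e rF != set0.
Proof.
move=> n0 ind pf mS hJ.
pose e1 := csem force e; pose e2 := csem (empty_set rC) (csem (empty_set rI) e1).
pose e3 := csem (CFor vx twosat_step) e2; pose e4 := csem maximalize e3.
change (csem solve e) with (csem check_partition (csem complement e4)).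
apply/check_partitionP => //; rewrite complement_sem.
have -> : csem complement e4 rI = e4 rI by [].
have E1 : e1 rK = forced (e rS) (e rJ) by exact: force_sem.
have [I2 C2 S2 J2] : [/\ e2 rI = set0, e2 rC = set0, e2 rS = e rS & e2 rJ = e rJ].
  by rewrite /e2 !empty_sem; split.
have K2 : e2 rK = forced (e rS) (e rJ) by rewrite /e2 !empty_sem !upd_neq.
have [E3 [S3 J3 K3]] := twosat_for_sem e2; rewrite -/e3 I2 C2 J2 K2 S2 in E3 S3 J3 K3.
have hs := sol_of_partition (e rS) ind pf; rewrite -hJ in hs.
have h3 := twosat_complete (@relA_sym G _) (@relR_sym G _ _) hs.
rewrite -E3 in h3.
have [h4 mx] := maximal_extension h3.
rewrite /e4 maximalize_sem K3; apply: (partition_of_sol (J0 := e rJ)) mS _ _ => //.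
by rewrite hJ subsetIl.
Qed.

Lemma label_pick_sem e : let e' := csem label_pick e in
  [/\ e' rc = first_set (e rS :\: e rL), e' rL = e rL :|: e' rc, e' rS = e rS & e' rJ = e rJ].
Proof.
pose e1 := csem (CPick rc rc (FAnd (FMeet rc rS) (FNot (FMeet rc rL)))) e.
cbv zeta; change (csem label_pick e) with (csem (CSet rL vv (FOr (FMeet vv rL) (FMeet vv rc))) e1).
split=> //; last by exact: compU1.
change (first_set (comp e rc (FAnd (FMeet rc rS) (FNot (FMeet rc rL)))) = first_set (e rS :\: e
  rL)).
congr first_set; apply/setP => x;
  rewrite in_set fsemAnd fsemNot !(@fsemMeet _ _ _ _ x) // !upd_neq //.
by rewrite inE andbC.
Qed.

Lemma label_in_sem e : let e' := csem label_in e in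
  [/\ e' rL = e rL :|: first_set (e rS :\: e rL), e' rS = e rS
    & e' rJ = e rJ :|: first_set (e rS :\: e rL)].
Proof.
have [h1 h2 h3 h4] := label_pick_sem e.
cbv zeta; change (csem label_in e) with (csem (CSet rJ vv (FOr (FMeet vv rJ) (FMeet vv rc))) (csem
  label_pick e)).
move: (csem label_pick e) h1 h2 h3 h4 => e1 h1 h2 h3 h4.
rewrite -h1 -h2; split=> //.
by rewrite -h4; exact: compU1.
Qed.

(** The right alternative follows [J]: the next vertex is put into [rJ] exactly if it lies in [J].
    When nothing is left to label, plain [label_pick] is used. *)
Lemma label_step e J : e rL \subset e rS -> e rJ = e rL :&: J ->
  exists2 i, i < size labels & let e' := csem (nth check_claw_free labels i) e in
  [/\ e' rS = e rS, e' rL \subset e' rS, e' rJ = e' rL :&: J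
    & #|e' rS :\: e' rL| <= #|e rS :\: e rL|.-1].
Proof.
move=> sL hJ; have [h1 h2 h3 h4] := label_pick_sem e; rewrite h1 in h2.
have [l1 l2 l3] := label_in_sem e.
case: (first_setP (e rS :\: e rL)) => [[E F]|[x]].
  exists 1 => //; cbv zeta; rewrite [nth _ _ _]/= h2 h3 h4 F setU0 E cards0; split=> //.
rewrite inE => /andP[xL xS] F; rewrite F in h2 l1 l3.
have sub : e rL :|: [set x] \subset e rS by rewrite subUset sL sub1set.
have card : #|e rS :\: (e rL :|: [set x])| <= #|e rS :\: e rL|.-1.
  by apply: (hit_card xS xL); rewrite ?subsetUl // !inE eqxx orbT.
have [xJ|xJ] := boolP (x \in J).
  exists 0 => //; cbv zeta; rewrite [nth _ _ _]/= l1 l2 l3 hJ; split=> //.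
  by rewrite setIUl; congr (_ :|: _); apply/esym/setIidPl; rewrite sub1set.
exists 1 => //; cbv zeta; rewrite [nth _ _ _]/= h2 h3 h4 hJ; split=> //.
rewrite setIUl [X in _ :|: X](_ : _ = set0) ?setU0 //; apply/eqP; rewrite setI_eq0 disjoints1.
exact: xJ.
Qed.

Lemma sched2E m : sched2 m = nseq (8 * m) labels ++ [:: [:: solve]].
Proof.
elim: m => // m IH; have -> : sched2 m.+1 = block2 ++ sched2 m by [].
by rewrite IH mulnS nseqD -catA.
Qed.

Lemma sched2_sound m e e' : 0 < #|G| -> reach (sched2 m) e e' -> e' rF != set0 ->
  [/\ e' rC = ~: e' rI, independent (e' rI) & p3_free (e' rC)].
Proof.
move=> n0; rewrite sched2E; elim: (8 * m) e => [|k IH] e; last by case=> i _ /IH.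
by case=> -[|//] _ <-; exact: solve_sound.
Qed.

(** The 8 m labelling levels suffice to label all of [rS], so that [rJ] has become its intersection
    with [J] when [solve] is run. *)
Lemma sched2_complete m e J : 0 < #|G| -> independent J -> p3_free (~: J) ->
  modulator (e rS) -> e rL = set0 -> e rJ = set0 -> #|e rS| <= 8 * m ->
  exists2 e', reach (sched2 m) e e' & e' rF != set0.
Proof.
move=> n0 ind pf mS hL hJ; rewrite sched2E.
have : #|e rS :\: e rL| <= #|e rS| by rewrite hL setD0.
have : e rL \subset e rS by rewrite hL sub0set.
have : e rJ = e rL :&: J by rewrite hJ hL set0I.
move=> {hL hJ} hJ sL h1 h2; have {h1 h2}h := leq_trans h1 h2.
elim: (8 * m) e mS sL hJ h => [|k IH] e mS sL hJ h.
  exists (csem solve e); first by exists 0.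
  apply: (solve_complete n0 ind pf) => //; rewrite hJ; congr (_ :&: _).
  by apply/eqP; rewrite eqEsubset sL -setD_eq0 -cards_eq0 -leqn0.
have [i hi] := label_step sL hJ; cbv zeta; set e1 := csem _ e => -[S1 L1 J1 c1].
have [||||e' hr he'] := IH e1 => //; first by rewrite S1.
  by move: c1 h; move: #|_ :\: _| #|_ :\: _| => a b; lia.
by exists e' => //; exists i.
Qed.
End Labelling.

(** * Claw-free deletion and cluster graphs in terms of vertices *)

Section Bridges.
Variable G : graph.
Implicit Types (x y z c a b d : G) (C J S : {set G}).

Lemma claw_free_modulator S : claw_free (induced (~: S)) -> modulator S.
Proof.
move=> h c a b d; apply: contraNN h => /andP[hcl /and4P[oc oa ob od]].
have mk x : x \notin S -> x \in ~: S by rewrite inE.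
pose V := vertex (induced (~: S)).
pose c' : V := exist _ c (mk _ oc); pose a' : V := exist _ a (mk _ oa).
pose b' : V := exist _ b (mk _ ob); pose d' : V := exist _ d (mk _ od).
pose f : {ffun claw -> V} := [ffun v : claw => if v is inr i then nth d' [:: a'; b'; d'] i else c'].
case/andP: hcl => h1 /andP[h2 /andP[h3 /andP[h4 /andP[h5 /andP[h6 /and3P[h7 h8 h9]]]]]].
have adjE u v : adj (f u) (f v) = adj u v.
  rewrite !ffunE; case: u v => [u|[[|[|[|//]]] hu]] [v|[[|[|[|//]]] hv]];
  rewrite /= /induced_adj /= ?adj_irr ?h1 ?h2 ?h3 ?(negPf h4) ?(negPf h5) ?(negPf h6) //;
  by rewrite adj_sym ?h1 ?h2 ?h3 ?(negPf h4) ?(negPf h5) ?(negPf h6).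
apply/existsP; exists f; apply/andP; split; last first.
  by apply/forallP => u; apply/forallP => v; rewrite adjE.
apply/injectiveP => u v; rewrite !ffunE => /(congr1 val).
case: u v => [u|[[|[|[|//]]] hu]] [v|[[|[|[|//]]] hv]] /= E;
  try (by congr inl; rewrite !ord1); try (by congr inr; apply: val_inj); exfalso;
    move: h1 h2 h3 h7 h8 h9;
  by rewrite ?E ?eqxx ?adj_irr // -?E ?adj_irr ?eqxx.
Qed.

(** Cluster graphs are the graphs without an induced path on three vertices: in the absence of such
    paths reachability collapses to equality or adjacency. *)
Lemma p3_freeP C : cluster_graph (induced C) <-> p3_free C.
Proof.
split=> h.
  move=> x y z xC yC zC; apply/negP => /and4P[xy yz nxz xz].
  pose x' : induced C := exist _ x xC; pose y' : induced C := exist _ y yC;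
    pose z' : induced C := exist _ z zC.
  have cxy : connect adj x' y' by apply: connect1.
  have cyz : connect adj y' z' by apply: connect1.
  have xz' : adj x' z'.
    by apply: (h x'); rewrite ?inE ?connect0 // (connect_trans cxy cyz).
  by move: nxz; rewrite (xz' : adj x z).
(* Induction on the length of the path: its last edge and the edge from [x] to the last vertex but
   one would form an induced path. *)
have key (x y : induced C) : connect adj x y -> (x == y) || adj x y.
  case/connectP=> p; elim/last_ind: p y => [|p w IH] y /=; first by move=> _ ->; rewrite eqxx.
  rewrite rcons_path last_rcons => /andP[hp hw] ->; have /orP[/eqP->|hx] := IH _ hp erefl.
    by rewrite hw orbT.
  have [//|xw /=] := eqVneq x w.
  have := h (val x) (val (last x p)) (val w) (valP _) (valP _) (valP _).
  rewrite /p3 (hx : adj (val x) (val (last x p))) (hw : adj (val (last x p)) (val w)).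
  by rewrite (inj_eq val_inj) xw andbT negbK.
move=> x y z; rewrite !inE => xy xz yz.
have : connect adj y z.
  by apply: connect_trans xz; rewrite (sym_connect_sym (@adj_sym (induced C))).
by move/key; rewrite (negPf yz).
Qed.

Lemma monopolar_partition_p3 C J :
  monopolar_partition C J <-> C = ~: J /\ independent J /\ p3_free (~: J).
Proof.
split=> [[h1 h2 /p3_freeP h3 h4]|[-> [h1 h2]]].
  have E : C = ~: J.
    apply/setP => x; move/setP/(_ x): h1; move/setP/(_ x): h2; rewrite !inE.
    by case: (x \in C); case: (x \in J).
  by rewrite -E.
split=> //; last exact/p3_freeP.
  by rewrite setUC setUCr.
by rewrite setIC setICr.
Qed.

Lemma claw_free_deletionP : exists2 T : {set G}, modulator T & #|T| = claw_free_deletion_number G.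
Proof.
rewrite /claw_free_deletion_number.
case: arg_minnP => [|T hT _]; first exact: claw_free_delT.
by exists T => //; apply: claw_free_modulator.
Qed.
End Bridges.

(** * Polynomial bounds for the cost functions *)

Definition poly_bounded (f : nat -> nat) := exists c d, forall n, f n <= c * n.+1 ^ d.

Lemma poly_cst k : poly_bounded (fun=> k).
Proof. by exists k, 0 => n; rewrite muln1. Qed.

Lemma poly_succ : poly_bounded (fun n => n.+1).
Proof. by exists 1, 1 => n; rewrite mul1n. Qed.

Lemma poly_id : poly_bounded id.
Proof. by exists 1, 1 => n; rewrite mul1n expn1 leqnSn. Qed.

Lemma poly_add f g : poly_bounded f -> poly_bounded g -> poly_bounded (fun n => f n + g n).
Proof.
move=> [c [d hf]] [c' [d' hg]]; exists (c + c'), (d + d') => n; rewrite mulnDl leq_add //.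
  by apply: leq_trans (hf n) _; rewrite leq_mul2l leq_pexp2l ?leq_addr ?orbT.
by apply: leq_trans (hg n) _; rewrite leq_mul2l leq_pexp2l ?leq_addl ?orbT.
Qed.

Lemma poly_mul f g : poly_bounded f -> poly_bounded g -> poly_bounded (fun n => f n * g n).
Proof.
move=> [c [d hf]] [c' [d' hg]]; exists (c * c'), (d + d') => n.
by rewrite expnD mulnACA leq_mul.
Qed.

Lemma poly_base : poly_bounded base.
Proof. by apply: poly_mul (poly_cst _) (poly_mul poly_succ poly_succ). Qed.

Lemma poly_cost_f f : poly_bounded (cost_f^~ f).
Proof.
by elim: f => /= *; repeat first [apply: poly_base | apply: poly_succ | apply: poly_id | assumption
  | apply: poly_add | apply: poly_mul].
Qed.

Lemma poly_cost_c c : poly_bounded (cost_c^~ c).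
Proof.
by elim: c => /= *; repeat first [apply: poly_base | apply: poly_succ | apply: poly_id | assumption
  | apply: poly_cost_f
  | apply: poly_add | apply: poly_mul].
Qed.

Lemma poly_level_cost : poly_bounded level_cost.
Proof.
apply: poly_add (poly_cst _); apply: poly_add poly_base.
rewrite /max_cost; elim: (flatten cmds) => [|c cs IH] /=; first exact: poly_cst.
exact: poly_add (poly_cost_c c) IH.
Qed.

Definition const_cost := block_size block1 + block_size block2 + 2000 +
  tsize (enc_sched (sched1 0)) + tsize (enc_sched (sched2 0)).

(** A bound on the number of rounds times the cost of a round with 256 ^ M taken out, for M at most
    n + 1. *)
Definition time_factor n :=
  (n.+1 + 1) * (2 * ((8 * n.+1 + 3) * level_cost n) + const_cost) + base n + const_cost.

Lemma poly_time_factor : poly_bounded time_factor.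
Proof.
by repeat first [apply: poly_base | apply: poly_succ | apply: poly_id | apply: poly_level_cost |
  apply: poly_cst
  | apply: poly_add | apply: poly_mul].
Qed.

Lemma total_cost n M : M <= n.+1 ->
  M.+1 * loop_cost n M + base n + tsize (enc_sched (sched1 0)) + tsize (enc_sched (sched2 0))
  <= time_factor n * 256 ^ M.
Proof.
move=> hM; rewrite /time_factor /loop_cost /stage_cost /const_cost.
move: (block_size block1) (block_size block2) (tsize (enc_sched (sched1 0))) (tsize (enc_sched
  (sched2 0))) (base n) (level_cost n) => a b c d q l.
have : 0 < 256 ^ M by rewrite expn_gt0.
move: (256 ^ M) => w w0.
have h1 : (8 * M + 3) * l * w <= (8 * n.+1 + 3) * l * w by rewrite !leq_mul2r; apply/orP; right;
  apply/orP; right; lia.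
have h2 : 2 * ((8 * M + 3) * l * w) + a + b + 2000 <= (2 * ((8 * n.+1 + 3) * l) + (a + b + 2000 + c
  + d)) * w.
  rewrite mulnDl -!mulnA; have : a + b + 2000 <= (a + b + 2000 + c + d) * w.
    by apply: leq_trans (leq_pmulr _ w0); lia.
  by move: h1; rewrite -!mulnA; lia.
have h3 : M.+1 * (2 * ((8 * M + 3) * l * w) + a + b + 2000) <=
   (n.+1 + 1) * ((2 * ((8 * n.+1 + 3) * l) + (a + b + 2000 + c + d)) * w).
  by apply: leq_mul h2; lia.
have h4 : q + c + d <= (q + (a + b + 2000 + c + d)) * w.
  by apply: leq_trans (leq_pmulr _ w0); lia.
have E x y z : (x + y + z) * w = x * w + (y + z) * w by rewrite -addnA mulnDl.
rewrite E -(mulnA (n.+1 + 1)) -(addnA _ q c) -(addnA _ (q + c) d).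
exact: leq_add h3 h4.
Qed.

(** * The run of the program on a given graph *)

Lemma monopolar_run (G : graph) : exists (answer : option ({set G} * {set G})) (t : nat),
  [/\ runs prog (enc_graph G) (enc_answer answer) t,
      t <= time_factor (gorder G) * 256 ^ (claw_free_deletion_number G %/ 5).+1
    & match answer with
      | Some (C, J) => monopolar_partition C J
      | None => ~ monopolar G
      end].
Proof.
(* With M = k / 5 + 1, rounded down before adding one, the budget 5 M exceeds k, so the first stage
   succeeds with M blocks at the latest. *)
set k := claw_free_deletion_number G; set M := (k %/ 5).+1.
have [n0|n0] := posnP #|G|.
  have eG : enum G = [::] by apply/eqP; rewrite -size_eq0 -cardE n0.
  have x0 (x : G) : False by have := max_card (pred1 x); rewrite card1 n0.
  have [t ht hB] : evalb [:: enc_graph G] e_main (Node Leaf Leaf) 10.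
    by rewrite /enc_graph eG; rewrite /e_main; eapply evb_le; [ev | |].
  exists (Some (set0, set0)), t; split.
  - by rewrite /enc_answer /enc_set eG.
  - apply: leq_trans hB _; apply: leq_trans (leq_pmulr _ _); last by rewrite expn_gt0.
    by rewrite /time_factor /const_cost; lia.
  apply/monopolar_partition_p3; split; first by apply/setP => x; case: (x0 x).
  by split=> x; case: (x0 x).
have [T mT cT] := claw_free_deletionP G.
have kn : k <= gorder G by rewrite /k -cT max_card.
pose e0 : nat -> {set G} := fun=> set0.
have hM : isSome (search (sched1 M) e0).
  have [|e' hr he'] := sched1_complete (m := M) (e := e0) n0 mT.
    right; apply: leq_trans (subset_leq_card (subsetDl _ _)) _.
    by rewrite cT -/k /M; have := ltn_pmod k (isT : 0 < 5); have := divn_eq k 5; lia.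
  by case E: (search _ _) => //; rewrite (search_none E hr) eqxx in he'.
have [m [e1 [E1 [t ht hB]]]] := run_main n0 (fun=> erefl) hM.
have [r1 f1] := search_some E1; have [mS cS hL hJ] := sched1_sound n0 r1 f1.
have tB : t <= time_factor (gorder G) * 256 ^ M.
  apply: leq_trans hB (total_cost _); rewrite /M ltnS; apply: leq_trans kn; exact: leq_div.
case E2: (search (sched2 m) e1) ht => [e2|] ht.
  exists (Some (e2 rC, e2 rI)), t; split=> //.
  have [r2 f2] := search_some E2; have [hC ind pf] := sched2_sound n0 r2 f2.
  by apply/monopolar_partition_p3; rewrite -hC.
(* A monopolar partition would lead the second stage to a leaf with nonempty flag, which the failed
   search excludes. *)
exists None, t; split=> // -[C [J /monopolar_partition_p3 [_ [ind pf]]]].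
have [|e2 r2 f2] := sched2_complete (m := m) n0 ind pf mS hL hJ; first by rewrite cards0 in cS.
by rewrite (search_none E2 r2) eqxx in f2.
Qed.

(** * The base of the exponential factor *)

Import Order.TTheory GRing.Theory Num.Theory.
Local Open Scope ring_scope.

(** One factor [y] pays for the last block; the others are grouped by five. *)
Lemma exp_div5_le (x y : rat) k : 0 <= y -> 1 <= x -> y <= x ^+ 5 -> y ^+ (k %/ 5).+1 <= y * x ^+ k.
Proof.
move=> y0 x1 x5; rewrite exprS ler_wpM2l //; apply: (@le_trans _ _ (x ^+ (5 * (k %/ 5)))).
  by rewrite exprM; apply: lerXn2r => //; rewrite nnegrE exprn_ge0 // (le_trans _ x1).
by rewrite ler_weXn2l // mulnC leq_trunc_div.
Qed.

(** The fifth root of 256 is about 3.0314, so 3.04 already suffices as a base. *)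
Lemma expn256_le (x : rat) k : 304%:R / 100%:R <= x ->
  ((256 ^ (k %/ 5).+1)%N%:R : rat) <= 256%:R * x ^+ k.
Proof.
move=> x3; have x1 : 1 <= x by lra.
have x5 : 256%:R <= x ^+ 5.
  (* Powers rounded down: 3.04 ^ 2 = 9.2416, 9.24 ^ 2 = 85.3776 and 85.3 * 3.04 = 259.312. *)
  have h2 : 924%:R / 100%:R <= x ^+ 2 by rewrite expr2; nra.
  have h4 : 853%:R / 10%:R <= x ^+ 4 by rewrite (exprM x 2 2) [_ ^+ 2 ^+ 2]expr2; nra.
  by rewrite exprSr; nra.
rewrite natrX; apply: exp_div5_le x1 x5; exact: ler0n.
Qed.

Lemma time_bound (x : rat) (c d n k t : nat) : 304%:R / 100%:R <= x ->
  (t <= c * n.+1 ^ d * 256 ^ (k %/ 5).+1)%N ->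
  (t%:R : rat) <= (c * 256)%N%:R * n.+1%:R ^+ d * x ^+ k.
Proof.
move=> /(expn256_le k) hx; rewrite -(ler_nat rat) => /le_trans; apply.
move: hx; rewrite (natrM _ c 256) natrM (natrM _ c (_ ^ d)) (natrX _ _ d).
move: (256%:R : rat) ((256 ^ _)%N%:R : rat) => y z hz.
rewrite -(mulrA c%:R y) [y * _]mulrC mulrA -(mulrA _ y).
by apply: ler_wpM2l => //; rewrite mulr_ge0 ?exprn_ge0 ?ler0n.
Qed.

Theorem theorem3 :
  exists (p : program) (c d : nat),
  forall G : graph,
  exists (answer : option ({set G} * {set G})) (t : nat),
    [/\ runs p (enc_graph G) (enc_answer answer) t,
        (t%:R : rat) <= c%:R * (#|G|.+1)%:R ^+ d
                        * (3076%:R / 1000%:R) ^+ claw_free_deletion_number G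
      & match answer with
        | Some (C, J) => monopolar_partition C J
        | None => ~ monopolar G
        end].
Proof.
(* The factor 256 comes from the additional one in the exponent k / 5 + 1. *)
have [c [d hcd]] := poly_time_factor; exists prog, (c * 256)%N, d => G.
have [answer [t [hr ht ha]]] := monopolar_run G; exists answer, t; split=> //.
apply: (@time_bound _ c d #|G|); first by lra.
by apply: leq_trans ht _; rewrite leq_mul2r hcd orbT.
Qed.
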